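(* Let $M,N\geq1$ be integers, let $Q\in M_{M\times N}(\mathbb T)$ be any matrix with entries on the unit circle, and let $H=F_M\otimes_QF_N\in M_{MN}(\mathbb C)$ be the deformed Fourier matrix, given by $H_{ia,jb}=Q_{ib}(F_M)_{ij}(F_N)_{ab}$. Let $G_H,G_{H^t}\subset S_{MN}^+$ be the quantum groups associated to $H$ and to its transpose $H^t$. Then $$\int_{G_H}\varphi(\chi)=\int_{G_{H^t}}\varphi(\chi)$$ for any continuous function $\varphi:[0,MN]\to\mathbb C$, where on each side $\chi$ is the main character of the corresponding quantum group and the integral is with respect to its Haar functional. In other words, the laws of the main characters satisfy $\mu_H=\mu_{H^t}$.
   Context: $F_N=(w^{ij})_{i,j=0,\ldots,N-1}$ with $w=e^{2\pi i/N}$ is the Fourier matrix; the indices of $H=F_M\otimes_QF_N$ are pairs $(i,a)$ with $i\in\{0,\ldots,M-1\}$, $a\in\{0,\ldots,N-1\}$. $H$ is a complex Hadamard matrix, i.e. its entries are on the unit circle $\mathbb T$ and its rows are pairwise orthogonal. The quantum group associated to a complex Hadamard matrix $H\in M_n(\mathbb C)$ is defined as follows. A magic matrix is a square matrix over a $C^*$-algebra whose entries are projections ($p=p^2=p^*$) summing up to $1$ on each row and column. $C(S_n^+)$ is the universal $C^*$-algebra generated by the entries of an $n\times n$ magic matrix $u=(u_{ij})$, with $\Delta(u_{ij})=\sum_ku_{ik}\otimes u_{kj}$, $\varepsilon(u_{ij})=\delta_{ij}$, $S(u_{ij})=u_{ji}$. Let $H_1,\ldots,H_n$ be the rows of $H$,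 and let $P_{ij}=Proj(H_i/H_j)\in M_n(\mathbb C)$ be the rank one orthogonal projection onto the line spanned by the entrywise quotient $H_i/H_j$. Then $(P_{ij})$ is magic, so $\pi:u_{ij}\mapsto P_{ij}$ defines a $*$-homomorphism $C(S_n^+)\to M_n(\mathbb C)$. The quantum group $G=G_H\subset S_n^+$ is the minimal one for which $\pi$ factors as $C(S_n^+)\to C(G)\xrightarrow{\rho}M_n(\mathbb C)$, the first map being the quotient map of Hopf algebras corresponding to $G\subset S_n^+$ (at the level of the $*$-algebras generated by the $u_{ij}$: divide by the largest Hopf $*$-ideal contained in $\ker\pi$; $C(G)$ is the enveloping $C^*$-algebra of the quotient). The images of $u_{ij}$ in $C(G)$ are still denoted $u_{ij}$. The main character is $\chi=\sum_iu_{ii}\in C(G)$, which satisfies $0\leq\chi\leq n$, and $\mu_H$ is its law with respect to the Haar functional $\int_G$ of $C(G)$, a probability measure on $[0,n]$. *)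

(* Defs.v *)
From HB Require Import structures.
From mathcomp Require Import all_boot all_order all_algebra.
From mathcomp Require Import all_classical all_reals all_analysis.
From mathcomp Require Import finmap complex mxtens.
From mathcomp Require monalg.
(* The notations of monalg clash with those of MathComp-Analysis. *)
Import -(notations) monalg.

Set Implicit Arguments.
Unset Strict Implicit.
Unset Printing Implicit Defensive.

Import Order.TTheory GRing.Theory Num.Theory.
Import numFieldNormedType.Exports.

Local Open Scope classical_set_scope.
Local Open Scope ring_scope.

(* Unital C*-algebras. MathComp-Analysis has no join of its normed modules with
   noncommutative rings, so that the norm and its completeness are part of the
   interface. *)
HB.mixin Record isCStarAlgebra (R : realType) A of GRing.Algebra R[i] A := {
  adj : A -> A ;
  adjK : involutive adj ;
  adjD : forall x y : A, adj (x + y) = adj x + adj y ;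
  adjZ : forall (c : R[i]) (x : A), adj (c *: x) = c^* *: adj x ;
  adjM : forall x y : A, adj (x * y) = adj y * adj x ;
  cnorm : A -> R ;
  cnorm_ge0 : forall x : A, 0 <= cnorm x ;
  cnorm_eq0 : forall x : A, cnorm x = 0 -> x = 0 ;
  cnormD : forall x y : A, cnorm (x + y) <= cnorm x + cnorm y ;
  cnormZ : forall (c : R[i]) (x : A),
    cnorm (c *: x) = complex.Re `|c| * cnorm x ;
  cnormM : forall x y : A, cnorm (x * y) <= cnorm x * cnorm y ;
  cnorm_adj : forall x : A, cnorm (adj x * x) = cnorm x ^+ 2 ;
  cnorm_complete : forall u : nat -> A,
    (forall e : R, 0 < e -> exists m, forall p q,
       (m <= p)%N -> (m <= q)%N -> cnorm (u p - u q) < e) ->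
    exists l : A, forall e : R, 0 < e -> exists m, forall p,
      (m <= p)%N -> cnorm (u p - l) < e
}.

#[short(type="cstarAlgType")]
HB.structure Definition CStarAlgebra (R : realType) :=
  { A of GRing.Algebra R[i] A & isCStarAlgebra R A }.

Definition is_projection (R : realType) (A : cstarAlgType R) (p : A) : Prop :=
  p * p = p /\ adj p = p.

Definition is_magic (R : realType) (A : cstarAlgType R) (n : nat)
    (v : 'I_n -> 'I_n -> A) : Prop :=
  [/\ forall i j, is_projection (v i j),
      forall i, \sum_j v i j = 1
    & forall j, \sum_i v i j = 1].

(* The product of two monoids, so that {malg C[K * L]} is the algebra
   C[K] (x) C[L]. *)
Section ProductMonoid.
Variables K L : monomType.
Implicit Types x y z : (K * L)%type.

Definition pair_one : (K * L)%type := (mone, mone).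
Definition pair_mul x y : (K * L)%type := (mmul x.1 y.1, mmul x.2 y.2).

Fact pair_mulA : associative pair_mul.
Proof. by move=> x y z; rewrite /pair_mul /= !mulmA. Qed.

Fact pair_mul1m : left_id pair_one pair_mul.
Proof. by case=> x y; rewrite /pair_mul /= !mul1m. Qed.

Fact pair_mulm1 : right_id pair_one pair_mul.
Proof. by case=> x y; rewrite /pair_mul /= !mulm1. Qed.

Fact pair_unitm x y : pair_mul x y = pair_one -> x = pair_one /\ y = pair_one.
Proof.
by case: x y => [x1 x2] [y1 y2] [] /unitm[-> ->] /unitm[-> ->].
Qed.

HB.instance Definition _ :=
  Choice_isMonomialDef.Build (K * L)%type
    pair_mulA pair_mul1m pair_mulm1 pair_unitm.
End ProductMonoid.

(* Words in the n^2 letters (i, j), and the free algebra on them, whose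
   generators stand for the coordinates u_ij. *)
Definition word (n : nat) := fmonom ('I_n * 'I_n)%type.
Definition freeAlg (R : realType) (n : nat) := malg (word n) R[i].
Definition freeAlg2 (R : realType) (n : nat) :=
  malg (word n * word n)%type R[i].


Definition lin_ext (R : realType) (K : choiceType) (V : lmodType R[i])
    (f : K -> V) (a : malg K R[i]) : V :=
  \sum_(k <- msupp a) mcoeff k a *: f k.

Definition word_prod (n : nat) (A : pzRingType) (v : 'I_n -> 'I_n -> A)
    (w : word n) : A :=
  \prod_(g <- (w : seq _)) v g.1 g.2.

Section FreeHopf.
Variables (R : realType) (n : nat).
Local Notation C := R[i].
Local Notation F := (freeAlg R n).
Local Notation F2 := (freeAlg2 R n).
Implicit Types (a b x y : F).

Definition word_elt (w : word n) : F := mkmalgU w 1.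
Definition letter (i j : 'I_n) : F := word_elt (fmu (i, j)).

(* The unital algebra morphism F -> A with u_ij |-> v i j. *)
Definition free_eval (A : lalgType C) (v : 'I_n -> 'I_n -> A) (a : F) : A :=
  lin_ext (word_prod v) a.

Definition tens (a b : F) : F2 :=
  \sum_(w <- msupp a) \sum_(z <- msupp b)
    mkmalgU (w, z) (mcoeff w a * mcoeff z b).

Definition comul (a : F) : F2 :=
  free_eval (fun i j => \sum_k tens (letter i k) (letter k j)) a.

Definition counit (a : F) : C := free_eval (fun i j => (i == j)%:R : C^o) a.

(* The linear antimultiplicative map with u_ij |-> u_ji. *)
Definition antipode (a : F) : F :=
  lin_ext (fun w : word n => \prod_(g <- rev (w : seq _)) letter g.2 g.1) a.

(* The antilinear antimultiplicative involution with u_ij^* = u_ij. *)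
Definition star (a : F) : F :=
  \sum_(w <- msupp a)
    (mcoeff w a)^* *: \prod_(g <- rev (w : seq _)) letter g.1 g.2.

(* The relations satisfied by the generators u_ij of the universal C*-algebra
   C(S_n^+), i.e., the kernel of F -> C(S_n^+): the *-algebra generated by the
   u_ij in C(S_n^+) is F modulo this ideal. *)
Definition magic_kernel : set F :=
  [set a | forall (A : cstarAlgType R) (v : 'I_n -> 'I_n -> A),
     is_magic v -> free_eval v a = 0].

(* J (x) F + F (x) J *)
Definition tens_ideal (J : set F) : set F2 :=
  [set t | exists s : seq (F * F),
     (forall p, p \in s -> J p.1 \/ J p.2) /\
     t = \sum_(p <- s) tens p.1 p.2].

(* Hopf *-ideals of F / magic_kernel, seen as ideals of F. *)
Record is_hopf_star_ideal (J : set F) : Prop := {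
  hopf_ideal_magic : magic_kernel `<=` J ;
  hopf_idealD : forall x y, J x -> J y -> J (x + y) ;
  hopf_idealM : forall a x b, J x -> J (a * x * b) ;
  hopf_ideal_star : forall x, J x -> J (star x) ;
  hopf_ideal_comul : forall x, J x -> tens_ideal J (comul x) ;
  hopf_ideal_counit : forall x, J x -> counit x = 0 ;
  hopf_ideal_antipode : forall x, J x -> J (antipode x)
}.
End FreeHopf.

Section HadamardQuantumGroup.
Variables (R : realType) (n : nat) (H : 'M[R[i]]_n).
Local Notation C := R[i].

(* The orthogonal projection x |-> <x, v> v / <v, v> onto the line spanned by
   v, as a matrix acting on column vectors. *)
Definition line_proj (v : 'I_n -> C) : 'M[C]_n :=
  \matrix_(k, l) (v k * (v l)^* / \sum_m `|v m| ^+ 2).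

Definition hadamard_proj (i j : 'I_n) : 'M[C]_n :=
  line_proj (fun k => H i k / H j k).

(* This is not free_eval, since 'M_n is a nontrivial ring only for n > 0. *)
Definition hadamard_rep (a : freeAlg R n) : 'M[C]_n :=
  lin_ext (word_prod hadamard_proj) a.

Definition is_largest_hopf_ideal (J : set (freeAlg R n)) : Prop :=
  [/\ is_hopf_star_ideal J,
      forall a, J a -> hadamard_rep a = 0
    & forall I, is_hopf_star_ideal I -> (forall a, I a -> hadamard_rep a = 0) ->
        I `<=` J].

(* The quantum group G_H, given by the C*-algebra C(G_H) with its coordinates
   u_ij: the enveloping C*-algebra of the quotient of the *-algebra of S_n^+ by
   the largest Hopf *-ideal contained in the kernel of hadamard_rep. As
   u_ij^* = u_ij, a *-morphism from that quotient to a C*-algebra amounts to a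
   matrix of self-adjoint elements satisfying the relations in the ideal. *)
Record hadamard_qgroup := HadamardQGroup {
  qg_ideal : set (freeAlg R n) ;
  qg_alg :> cstarAlgType R ;
  qg_coord : 'I_n -> 'I_n -> qg_alg ;
  qg_ideal_largest : is_largest_hopf_ideal qg_ideal ;
  qg_coord_adj : forall i j, adj (qg_coord i j) = qg_coord i j ;
  qg_coord_rel : forall a, qg_ideal a -> free_eval qg_coord a = 0 ;
  qg_univ : forall (A : cstarAlgType R) (v : 'I_n -> 'I_n -> A),
    (forall i j, adj (v i j) = v i j) ->
    (forall a, qg_ideal a -> free_eval v a = 0) ->
    exists f : {lrmorphism qg_alg -> A},
      [/\ forall x, f (adj x) = adj (f x),
          forall i j, f (qg_coord i j) = v i j
        & forall g : {lrmorphism qg_alg -> A},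
            (forall x, g (adj x) = adj (g x)) ->
            (forall i j, g (qg_coord i j) = v i j) -> g =1 f]
}.

Definition main_char (G : hadamard_qgroup) : G := \sum_i qg_coord G i i.

(* The Haar functional: the bi-invariant state of C(G). Invariance is tested
   on the dense *-subalgebra generated by the coordinates, where the
   comultiplication has values in an algebraic tensor product. *)
Record is_haar (G : hadamard_qgroup) (h : {scalar G}) : Prop := {
  haar1 : h 1 = 1 ;
  haar_pos : forall x : G, 0 <= h (adj x * x) ;
  haar_left : forall a : freeAlg R n,
    lin_ext (fun p : (word n * word n)%type =>
        h (word_prod (@qg_coord G) p.1) *: word_prod (@qg_coord G) p.2)
      (comul a) = h (free_eval (@qg_coord G) a) *: 1 ;
  haar_right : forall a : freeAlg R n,
    lin_ext (fun p : (word n * word n)%type =>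
        h (word_prod (@qg_coord G) p.2) *: word_prod (@qg_coord G) p.1)
      (comul a) = h (free_eval (@qg_coord G) a) *: 1
}.
End HadamardQuantumGroup.

Definition continuous_upto (R : realType) (n : nat) (f : R -> R[i]^o) : Prop :=
  {within `[0, n%:R]%classic, continuous f}.

(* Phi is the continuous functional calculus f |-> f(a) of an element a with
   spectrum in [0, n], i.e., the unique unital *-morphism C([0, n]) -> A that
   maps the identity function to a. An element of C([0, n]) is represented by
   any function R -> C that restricts to it; the values of Phi at the
   functions that are not continuous on [0, n] are irrelevant. *)
Record is_functional_calculus (R : realType) (A : cstarAlgType R) (n : nat)
    (a : A) (Phi : (R -> R[i]^o) -> A) : Prop := {
  fcalc_ext : forall f g, continuous_upto n f -> continuous_upto n g ->
    (forall x : R, 0 <= x <= n%:R -> f x = g x) -> Phi f = Phi g ;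
  fcalcD : forall f g, continuous_upto n f -> continuous_upto n g ->
    Phi (fun x => f x + g x) = Phi f + Phi g ;
  fcalcZ : forall (c : R[i]) f, continuous_upto n f ->
    Phi (fun x => c * f x) = c *: Phi f ;
  fcalcM : forall f g, continuous_upto n f -> continuous_upto n g ->
    Phi (fun x => f x * g x) = Phi f * Phi g ;
  fcalc1 : Phi (fun=> 1) = 1 ;
  fcalc_adj : forall f, continuous_upto n f ->
    Phi (fun x => (f x)^*) = adj (Phi f) ;
  fcalc_id : Phi (fun x => x%:C%C) = a
}.

(* mu, as a measure on R carried by [0, n], is the law with respect to h of the
   element whose functional calculus is Phi. *)
Definition is_law (R : realType) (A : cstarAlgType R) (n : nat) (h : {scalar A})
    (Phi : (R -> R[i]^o) -> A) (mu : probability R R) : Prop :=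
  mu `[0, n%:R]%classic = 1%E /\
  forall f, continuous_upto n f ->
    h (Phi f) =
      ((\int[mu]_(x in `[0%R, n%:R]) complex.Re (f x)) +i*
       (\int[mu]_(x in `[0%R, n%:R]) complex.Im (f x)))%C.

Definition root_of_unity (R : realType) (N : nat) : R[i] :=
  (cos (2 * pi / N%:R) +i* sin (2 * pi / N%:R))%C.

Definition fourier (R : realType) (N : nat) : 'M[R[i]]_N :=
  \matrix_(i, j) root_of_unity R N ^+ (i * j)%N.

(* A pair (i, a) is numbered i * N + a. *)
Definition deformed_fourier (R : realType) (M N : nat) (Q : 'M[R[i]]_(M, N)) :
    'M[R[i]]_(M * N) :=
  \matrix_(x, y)
    let: (i, a) := mxtens_unindex x in
    let: (j, b) := mxtens_unindex y in
    Q i b * fourier R M i j * fourier R N a b.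

(* Main.v *)
Require Import Defs.
From HB Require Import structures.
From mathcomp Require Import all_boot all_order all_algebra.
From mathcomp Require Import all_classical all_reals all_analysis.
From mathcomp Require Import measurable_realfun.
From mathcomp Require Import finmap complex mxtens ring lra.
From mathcomp Require monalg.
Import -(notations) monalg.

(* The Haar moments h(u_(i_1 j_1) ... u_(i_p j_p)) form an idempotent matrix, whose
   trace is the p-th moment of the main character. Its range is the space of the
   vectors xi fixed by the p-th tensor power of the model:
     sum_j xi_j P_(i_1 j_1) ... P_(i_p j_p) = xi_i 1   for all i.
   That columns are fixed follows from the invariance of h and the morphism from
   C(G) to the matrices. Conversely the relations expressing that u fixes the
   vectors fixed by the model generate, together with the ideal of G, a Hopf
   *-ideal contained in the kernel of the model, so that they hold in C(G) by
   maximality.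
   For the deformed Fourier matrix, a Fourier transform in the indices a_s
   identifies the fixed vectors with the functions eta(i, b) on Z_M^p x Z_N^p that
   are invariant under the diagonal translations of b, and whose quotient by
     Phi(i, b) = prod_s Q(i_s, b_(s-1)) / Q(i_s, b_s)
   is invariant under the diagonal translations of i. For the transpose the roles of
   i and b are exchanged and Phi is replaced by its inverse, up to a rotation of b.
   Hence eta / Phi runs through the fixed vectors of the transpose: the two
   idempotents have the same trace and the two laws have the same moments.
   Positivity of h and Weierstrass' theorem extend this to continuous functions. *)

Set Implicit Arguments.
Unset Strict Implicit.
Unset Printing Implicit Defensive.

Import Order.TTheory GRing.Theory Num.Theory.
Import numFieldNormedType.Exports.

Local Open Scope classical_set_scope.
Local Open Scope ring_scope.

(** * Monoid algebras and the free algebra *)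

(** C(G) is accessible only through its universal property and the maximality of its ideal, and the
    model need not be faithful on it. Hence no Haar moment is ever computed: all that is known of
    each moment matrix is that its columns are fixed vectors and that it fixes every fixed vector,
    and this already determines its trace through the fixed space. The phase comes from a closed
    walk. P_((i,a),(j,b)) depends on a and b only through a - b, and its Fourier transform at the
    frequency c moves a point mass at z in Z_N to one at z - c, with a weight made of entries of Q.
    A product of such matrices returns a point mass to its place only if the frequencies sum to
    zero; so they are written as differences of cyclically consecutive b_s, the positions of the
    walk, and the weights met on the way multiply to Phi(i, b) / Phi(j, b). Frequencies with nonzero
    sum do not occur, since a fixed vector is invariant under the diagonal translations of a. *)

Section SemilinearExtension.
Variables (R : realType) (K : choiceType) (s : {rmorphism R[i] -> R[i]}).
Local Notation C := R[i].

(** The twist [s] of the coefficients lets the same lemmas serve the linear maps (evaluation,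
    comultiplication, antipode, with [idfun]) and the antilinear star (with [Num.conj]). *)
Definition semilin_ext (V : lmodType C) (f : K -> V) (a : malg K C) : V :=
  \sum_(k <- msupp a) s (mcoeff k a) *: f k.

Lemma eq_semilin_ext (V : lmodType C) (f g : K -> V) a :
  f =1 g -> semilin_ext f a = semilin_ext g a.
Proof. by move=> fg; apply: eq_bigr => k _; rewrite fg. Qed.

Lemma semilin_ext_funD (V : lmodType C) (f g : K -> V) a :
  semilin_ext (fun k => f k + g k) a = semilin_ext f a + semilin_ext g a.
Proof. by rewrite /semilin_ext -big_split; apply: eq_bigr => k _; rewrite scalerDr. Qed.

Lemma semilin_ext_funZ (V : lmodType C) c (f : K -> V) a :
  semilin_ext (fun k => c *: f k) a = c *: semilin_ext f a.
Proof.
by rewrite /semilin_ext scaler_sumr; apply: eq_bigr => k _; rewrite !scalerA mulrC.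
Qed.

Variables (V : lmodType C) (f : K -> V).

(** The support of a sum may be smaller than the union of the supports; summing over any larger
    finite set makes additivity a termwise computation. *)
Lemma semilin_extEw (d : {fset K}) a : (msupp a `<=` d)%fset ->
  semilin_ext f a = \sum_(k <- d) s (mcoeff k a) *: f k.
Proof.
move=> le_d; rewrite /semilin_ext (big_fset_incl _ le_d) // => k _ /mcoeff_outdom ->.
by rewrite rmorph0 scale0r.
Qed.

Lemma semilin_extD a b : semilin_ext f (a + b) = semilin_ext f a + semilin_ext f b.
Proof.
rewrite (semilin_extEw (msuppD_le a b)) (semilin_extEw (fsubsetUl (msupp a) (msupp b))).
rewrite (semilin_extEw (fsubsetUr (msupp a) (msupp b))) -big_split /=.
by apply: eq_bigr => k _; rewrite mcoeffD rmorphD scalerDl.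
Qed.

Lemma semilin_extZ c a : semilin_ext f (c *: a) = s c *: semilin_ext f a.
Proof.
rewrite (semilin_extEw (msuppZ_le c a)) /semilin_ext scaler_sumr.
by apply: eq_bigr => k _; rewrite mcoeffZ rmorphM scalerA.
Qed.

Lemma semilin_ext0 : semilin_ext f 0 = 0.
Proof. by rewrite -(scale0r (0 : malg K C)) semilin_extZ rmorph0 scale0r. Qed.

Lemma semilin_extU k c : semilin_ext f (mkmalgU k c) = s c *: f k.
Proof.
by rewrite (semilin_extEw msuppU_le) big_seq_fset1 mcoeffUU.
Qed.

Lemma semilin_ext_sum I r (P : pred I) (F : I -> malg K C) :
  semilin_ext f (\sum_(i <- r | P i) F i) = \sum_(i <- r | P i) semilin_ext f (F i).
Proof. exact: (big_morph _ semilin_extD semilin_ext0). Qed.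

End SemilinearExtension.

(* Below, monoid algebras are accessed through an abstract algebra spanned by a
   multiplicative family: unfolding their canonical structures makes unification
   intractable. *)
Section SpannedAlgebra.
Variables (R : realType) (K : monomType) (M : lalgType R[i]) (U : K -> M).
Local Notation C := R[i].
Hypothesis span_ind : forall P : M -> Prop, P 0 ->
  (forall a b, P a -> P b -> P (a + b)) -> (forall c k, P (c *: U k)) ->
  forall a, P a.
Hypothesis spanM : forall c c' k k',
  (c *: U k) * (c' *: U k') = (c * c') *: U (mmul k k').

Lemma span_scalerAr (c : C) (x y : M) : c *: (x * y) = x * (c *: y).
Proof.
elim/span_ind: x => [|x x' IH IH'|c' k]; first by rewrite !mul0r scaler0.
  by rewrite !mulrDl scalerDr IH IH'.
elim/span_ind: y => [|y y' IH IH'|c'' k']; first by rewrite !scaler0 !mulr0 scaler0.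
  by rewrite scalerDr !mulrDr scalerDr IH IH'.
by rewrite !scalerA !spanM scalerA mulrCA mulrA.
Qed.

Variables (s : {rmorphism C -> C}) (A : lalgType C) (f : M -> A).
Hypothesis scaleAr : forall c (x y : A), c *: (x * y) = x * (c *: y).
Hypothesis fD : forall a b, f (a + b) = f a + f b.
Hypothesis fZ : forall c a, f (c *: a) = s c *: f a.

Let f0 : f 0 = 0.
Proof. by rewrite -(scale0r (0 : M)) fZ rmorph0 scale0r. Qed.

Lemma spanM_ext : (forall k k', f (U (mmul k k')) = f (U k) * f (U k')) ->
  forall a b, f (a * b) = f a * f b.
Proof.
move=> fM a b.
elim/span_ind: a => [|x x' IH IH'|c k]; first by rewrite !(mul0r, f0).
  by rewrite !(mulrDl, fD) IH IH'.
elim/span_ind: b => [|x x' IH IH'|c' k']; first by rewrite !(mulr0, f0).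
  by rewrite !(mulrDr, fD) IH IH'.
by rewrite spanM !fZ fM -scalerAl -scaleAr scalerA rmorphM.
Qed.

Lemma span_anti_ext : (forall k k', f (U (mmul k k')) = f (U k') * f (U k)) ->
  forall a b, f (a * b) = f b * f a.
Proof.
move=> fM a b.
elim/span_ind: a => [|x x' IH IH'|c k]; first by rewrite !(mul0r, mulr0, f0).
  by rewrite mulrDl !fD mulrDr IH IH'.
elim/span_ind: b => [|x x' IH IH'|c' k']; first by rewrite !(mul0r, mulr0, f0).
  by rewrite mulrDr !fD mulrDl IH IH'.
by rewrite spanM !fZ fM -scalerAl -scaleAr scalerA rmorphM mulrC.
Qed.
Variables (M2 : lalgType C) (t : M -> M -> M2).
Hypothesis scaleAr2 : forall c (x y : M2), c *: (x * y) = x * (c *: y).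
Hypothesis tDl : forall a a' b, t (a + a') b = t a b + t a' b.
Hypothesis tDr : forall a b b', t a (b + b') = t a b + t a b'.
Hypothesis tZl : forall c a b, t (c *: a) b = c *: t a b.
Hypothesis tZr : forall c a b, t a (c *: b) = c *: t a b.

Lemma span_bilinear_mul :
  (forall w z w' z', t (U w) (U z) * t (U w') (U z')
     = t (U (mmul w w')) (U (mmul z z'))) ->
  forall a b a' b', t a b * t a' b' = t (a * a') (b * b').
Proof.
move=> tM a b a' b'.
have t0l x : t 0 x = 0 by rewrite -(scale0r (0 : M)) tZl scale0r.
have t0r x : t x 0 = 0 by rewrite -(scale0r (0 : M)) tZr scale0r.
elim/span_ind: a => [|x x' IH IH'|c w]; first by rewrite !(mul0r, t0l).
  by rewrite !(mulrDl, tDl) IH IH'.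
elim/span_ind: b => [|x x' IH IH'|d z]; first by rewrite !(mul0r, t0r).
  by rewrite !(mulrDl, tDr) IH IH'.
elim/span_ind: a' => [|x x' IH IH'|c' w']; first by rewrite !(mulr0, t0l).
  by rewrite !(mulrDr, tDl) IH IH'.
elim/span_ind: b' => [|x x' IH IH'|d' z']; first by rewrite !(mulr0, t0r).
  by rewrite !(mulrDr, tDr) IH IH'.
rewrite !spanM !(tZl, tZr) -tM !scalerA -scalerAl -scaleAr2 scalerA.
by rewrite mulrACA.
Qed.
End SpannedAlgebra.
Section MonoidAlgebra.
Variables (R : realType) (K : monomType).
Local Notation C := R[i].

Lemma malg_scaleU (c z : C) (k : K) :
  c *: mkmalgU k z = mkmalgU k (c * z) :> malg K C.
Proof. by apply/malgP => l; rewrite mcoeffZ !mcoeffU; case: (k == l); rewrite ?mulr0. Qed.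

Lemma malg_ind (P : malg K C -> Prop) :
  P 0 -> (forall a b, P a -> P b -> P (a + b)) ->
  (forall c k, P (c *: mkmalgU k 1)) -> forall a, P a.
Proof.
move=> P0 PD PU a; rewrite [a]monalgE; apply: big_ind => // k _.
by rewrite -[mcoeff k a]mulr1 -malg_scaleU.
Qed.

Lemma malg_spanM (c c' : C) (k k' : K) :
  (c *: mkmalgU k 1) * (c' *: mkmalgU k' 1)
    = (c * c') *: mkmalgU (mmul k k') 1 :> malg K C.
Proof. by rewrite 3!malg_scaleU !mulr1 malgM_def fgmulUU. Qed.

Lemma malg_scalerAr (c : C) (x y : malg K C) : c *: (x * y) = x * (c *: y).
Proof. exact: (span_scalerAr malg_ind malg_spanM). Qed.

Variables (s : {rmorphism C -> C}) (A : lalgType C) (f : K -> A).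
Hypothesis scaleAr : forall c (x y : A), c *: (x * y) = x * (c *: y).

Lemma semilin_ext1 : f mone = 1 -> semilin_ext s f 1 = 1.
Proof. by move=> f1; rewrite semilin_extU rmorph1 scale1r. Qed.

Lemma semilin_extM a b : (forall k k', f (mmul k k') = f k * f k') ->
  semilin_ext s f (a * b) = semilin_ext s f a * semilin_ext s f b.
Proof.
move=> fM; apply: (spanM_ext malg_ind malg_spanM scaleAr
  (semilin_extD s f) (semilin_extZ s f)) => k k'.
by rewrite !semilin_extU rmorph1 !scale1r fM.
Qed.

Lemma semilin_ext_anti a b : (forall k k', f (mmul k k') = f k' * f k) ->
  semilin_ext s f (a * b) = semilin_ext s f b * semilin_ext s f a.
Proof.
move=> fM; apply: (span_anti_ext malg_ind malg_spanM scaleAr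
  (semilin_extD s f) (semilin_extZ s f)) => k k'.
by rewrite !semilin_extU rmorph1 !scale1r fM.
Qed.

End MonoidAlgebra.

Section FreeAlgebra.
Variables (R : realType) (n : nat).
Local Notation C := R[i].
Local Notation F := (freeAlg R n).
Local Notation F2 := (freeAlg2 R n).

Lemma word_prod1 (A : pzRingType) (v : 'I_n -> 'I_n -> A) :
  word_prod v mone = 1.
Proof. by rewrite /word_prod fm1 big_nil. Qed.

Lemma word_prodM (A : pzRingType) (v : 'I_n -> 'I_n -> A) w w' :
  word_prod v (mmul w w') = word_prod v w * word_prod v w'.
Proof. by rewrite /word_prod fmM big_cat. Qed.

Lemma word_prodU (A : pzRingType) (v : 'I_n -> 'I_n -> A) i j :
  word_prod v (fmu (i, j)) = v i j.
Proof. by rewrite /word_prod fmU big_seq1. Qed.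

Section Eval.
Variables (A : lalgType C) (v : 'I_n -> 'I_n -> A).
Hypothesis scaleAr : forall c (x y : A), c *: (x * y) = x * (c *: y).

Lemma free_evalE : free_eval v = semilin_ext idfun (word_prod v).
Proof. by []. Qed.

Lemma free_evalD a b : free_eval v (a + b) = free_eval v a + free_eval v b.
Proof. exact: (semilin_extD idfun). Qed.

Lemma free_evalZ c a : free_eval v (c *: a) = c *: free_eval v a.
Proof. exact: (semilin_extZ idfun). Qed.

Lemma free_evalM a b : free_eval v (a * b) = free_eval v a * free_eval v b.
Proof. by apply: (semilin_extM idfun scaleAr) => w w'; rewrite word_prodM. Qed.

Lemma free_eval1 : free_eval v 1 = 1.
Proof. by apply: (semilin_ext1 idfun); rewrite word_prod1. Qed.

Lemma free_eval_word w : free_eval v (word_elt R w) = word_prod v w.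
Proof. by rewrite free_evalE semilin_extU scale1r. Qed.

Lemma free_eval_letter i j : free_eval v (letter R i j) = v i j.
Proof. by rewrite free_eval_word word_prodU. Qed.
End Eval.

Lemma word_elt_prod (w : word n) :
  word_elt R w = \prod_(g <- (w : seq _)) letter R g.1 g.2.
Proof.
case: w => s /=; elim: s => [|[i j] s IH].
  by rewrite big_nil -[RHS]/(word_elt R mone) /mone /= /one /= fmoneE.
rewrite big_cons -IH /letter /word_elt malgM_def fgmulUU mulr1; congr (mkmalgU _ _).
by rewrite /mmul /= /mul /= fmmulE fmuE.
Qed.

(** Peeling off one letter at a time reduces the equality of two antimultiplicative maps to their
    values on the letters. *)
Lemma free_ind (P : F -> Prop) : P 0 -> P 1 ->
  (forall a b, P a -> P b -> P (a + b)) -> (forall c a, P a -> P (c *: a)) ->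
  (forall i j a, P a -> P (letter R i j * a)) -> forall a, P a.
Proof.
move=> P0 P1 PD PZ PM; apply: malg_ind => // c w; apply: PZ.
rewrite -/(word_elt R w) word_elt_prod; elim: (w : seq _) => [|g s IH].
  by rewrite big_nil.
by rewrite big_cons; exact: PM.
Qed.

Section Tensor.

Lemma tensE (a b : F) : tens a b =
  semilin_ext idfun (fun w => semilin_ext idfun (fun z => mkmalgU (w, z) 1 : F2) b) a.
Proof.
rewrite /tens /semilin_ext; apply: eq_bigr => w _; rewrite scaler_sumr.
apply: eq_bigr => z _; rewrite scalerA.
by rewrite malg_scaleU mulr1.
Qed.

Lemma semilin_ext_tens (V : lmodType C) (f : (word n * word n)%type -> V) (a b : F) :
  semilin_ext idfun f (tens a b)
    = semilin_ext idfun (fun w => semilin_ext idfun (fun z => f (w, z)) b) a.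
Proof.
rewrite /tens semilin_ext_sum; apply: eq_bigr => w _.
rewrite semilin_ext_sum /semilin_ext scaler_sumr; apply: eq_bigr => z _.
by rewrite -[LHS]/(semilin_ext idfun _ _) semilin_extU scalerA.
Qed.

Lemma tensDl a a' b : tens (a + a') b = tens a b + tens a' b :> F2.
Proof. by rewrite !tensE semilin_extD. Qed.

Lemma tensZl c a b : tens (c *: a) b = c *: tens a b :> F2.
Proof. by rewrite !tensE semilin_extZ. Qed.

Lemma tensDr a b b' : tens a (b + b') = tens a b + tens a b' :> F2.
Proof.
rewrite !tensE -semilin_ext_funD; apply: eq_semilin_ext => w.
exact: semilin_extD.
Qed.

Lemma tensZr c a b : tens a (c *: b) = c *: tens a b :> F2.
Proof.
rewrite !tensE -semilin_ext_funZ; apply: eq_semilin_ext => w.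
exact: semilin_extZ.
Qed.

Lemma tensU (w z : word n) :
  tens (word_elt R w) (word_elt R z) = mkmalgU (w, z) 1 :> F2.
Proof. by rewrite tensE !semilin_extU !scale1r. Qed.

Lemma tens11 : tens 1 1 = 1 :> F2.
Proof. exact: tensU. Qed.

Lemma tens_ind (P : F2 -> Prop) : P 0 ->
  (forall a b, P a -> P b -> P (a + b)) -> (forall a b, P (tens a b)) ->
  forall a, P a.
Proof.
move=> P0 PD PT; apply: malg_ind => // c [w z].
by rewrite -tensU -tensZl; exact: PT.
Qed.

End Tensor.

Lemma tensM (a b a' b' : F) : tens a b * tens a' b' = tens (a * a') (b * b') :> F2.
Proof.
have tU w z w' z' : tens (word_elt R w) (word_elt R z)
      * tens (word_elt R w') (word_elt R z')
    = tens (word_elt R (mmul w w')) (word_elt R (mmul z z')) :> F2.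
  by rewrite !tensU malgM_def fgmulUU mulr1.
exact: (@span_bilinear_mul R (word n) F (fun w => mkmalgU w 1) (@malg_ind R (word n))
  (@malg_spanM R (word n)) F2 (@tens R n)
  (@malg_scalerAr R (word n * word n)%type) tensDl tensDr tensZl tensZr tU a b a' b').
Qed.

End FreeAlgebra.

(** * Ideals and relations of fixed vectors *)

Section IdealSpan.
Variables (R : realType) (F F2 : lalgType R[i]) (t : F -> F -> F2).
Local Notation C := R[i].

(** An inductive closure, so that stability under the Hopf operations and inclusion in a kernel are
    checked on generators only. Scalar multiples are instances of [ideal_spanM]. *)
Inductive ideal_span (X : set F) : set F :=
  | ideal_span_in x : X x -> ideal_span X x
  | ideal_span0 : ideal_span X 0
  | ideal_spanD x y : ideal_span X x -> ideal_span X y -> ideal_span X (x + y)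
  | ideal_spanM a x b : ideal_span X x -> ideal_span X (a * x * b).

(** For [t := tens] this is convertible to [tens_ideal]. *)
Definition tensor_ideal (J : set F) : set F2 :=
  [set u | exists s : seq (F * F),
     (forall p, p \in s -> J p.1 \/ J p.2) /\ u = \sum_(p <- s) t p.1 p.2].

Hypothesis tM : forall a b a' b', t a b * t a' b' = t (a * a') (b * b').
Hypothesis t_ind : forall P : F2 -> Prop, P 0 ->
  (forall u v, P u -> P v -> P (u + v)) -> (forall a b, P (t a b)) -> forall u, P u.

Lemma tensor_ideal_in J a b : J a \/ J b -> tensor_ideal J (t a b).
Proof.
move=> Jab; exists [:: (a, b)]; split; last by rewrite big_seq1.
by move=> p; rewrite inE => /eqP->.
Qed.

Lemma tensor_ideal0 J : tensor_ideal J 0.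
Proof. by exists [::]; split; rewrite ?big_nil. Qed.

Lemma tensor_idealD J u v :
  tensor_ideal J u -> tensor_ideal J v -> tensor_ideal J (u + v).
Proof.
move=> [r [Jr ->]] [s [Js ->]]; exists (r ++ s); split; last by rewrite big_cat.
by move=> p; rewrite mem_cat => /orP[/Jr|/Js].
Qed.

Lemma tensor_ideal_sum J I r (P : pred I) (f : I -> F2) :
  (forall i, P i -> tensor_ideal J (f i)) ->
  tensor_ideal J (\sum_(i <- r | P i) f i).
Proof.
by move=> Jf; apply: big_ind => //; [exact: tensor_ideal0 | exact: tensor_idealD].
Qed.

Lemma tensor_idealM X u v w :
  tensor_ideal (ideal_span X) u -> tensor_ideal (ideal_span X) (v * u * w).
Proof.
move=> [s [Js ->]]; elim/t_ind: v => [|v v' IH IH'|a b].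
- by rewrite !mul0r; exact: tensor_ideal0.
- by rewrite !mulrDl; exact: tensor_idealD.
elim/t_ind: w => [|w w' IH IH'|a' b'].
- by rewrite !mulr0; exact: tensor_ideal0.
- by rewrite !mulrDr; exact: tensor_idealD.
rewrite mulr_sumr mulr_suml big_seq; apply: tensor_ideal_sum => p /Js Jp.
rewrite !tM; apply: tensor_ideal_in.
by case: Jp => Jp; [left | right]; exact: ideal_spanM.
Qed.

Lemma ideal_span_comul X (D : F -> F2) :
  (forall a b, D (a + b) = D a + D b) -> (forall a b, D (a * b) = D a * D b) ->
  (forall x, X x -> tensor_ideal (ideal_span X) (D x)) ->
  forall x, ideal_span X x -> tensor_ideal (ideal_span X) (D x).
Proof.
move=> DD DM DX x; elim=> {x} [||x y _ IHx _ IHy|a x b _ IH]; first exact: DX.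
- have /eqP : D 0 + D 0 = D 0 + 0 by rewrite -DD !addr0.
  by rewrite (inj_eq (addrI _)) => /eqP->; exact: tensor_ideal0.
- by rewrite DD; exact: tensor_idealD.
- by rewrite !DM; exact: tensor_idealM.
Qed.

Lemma ideal_span_ker X (B : pzRingType) (f : F -> B) :
  (forall a b, f (a + b) = f a + f b) -> (forall a b, f (a * b) = f a * f b) ->
  (forall x, X x -> f x = 0) -> forall x, ideal_span X x -> f x = 0.
Proof.
move=> fD fM fX x; elim=> {x} [||x y _ IHx _ IHy|a x b _ IH]; first exact: fX.
- by apply: (addrI (f 0)); rewrite -fD !addr0.
- by rewrite fD IHx IHy addr0.
- by rewrite !fM IH mulr0 mul0r.
Qed.

Lemma ideal_span_anti X (f : F -> F) :
  (forall a b, f (a + b) = f a + f b) -> (forall a b, f (a * b) = f b * f a) ->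
  (forall x, X x -> ideal_span X (f x)) ->
  forall x, ideal_span X x -> ideal_span X (f x).
Proof.
move=> fD fM fX x; elim=> {x} [||x y _ IHx _ IHy|a x b _ IH]; first exact: fX.
- have -> : f 0 = 0 by apply: (addrI (f 0)); rewrite -fD !addr0.
  exact: ideal_span0.
- by rewrite fD; exact: ideal_spanD.
- by rewrite !fM mulrA; exact: ideal_spanM.
Qed.

End IdealSpan.

Section ReversedWords.

(** The antipode and the star reverse the order of the factors of a word; reversing the
    multi-indices compensates for it. *)
Definition rev_idx p (T : finType) (i : {ffun 'I_p -> T}) : {ffun 'I_p -> T} :=
  [ffun s => i (rev_ord s)].

Lemma rev_idxK p T : involutive (@rev_idx p T).
Proof. by move=> i; apply/ffunP => s; rewrite !ffunE rev_ordK. Qed.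

Lemma big_rev_idx (V : nmodType) p (T : finType) (f : {ffun 'I_p -> T} -> V) :
  \sum_i f i = \sum_i f (rev_idx i).
Proof. exact: (reindex_inj (can_inj (@rev_idxK p T))). Qed.

Lemma anti_prod (A B : pzRingType) (f : A -> B) p (x : 'I_p -> A) :
  f 1 = 1 -> (forall a b, f (a * b) = f b * f a) ->
  f (\prod_s x s) = \prod_s f (x (rev_ord s)).
Proof.
move=> f1 fM; elim: p x => [|p IH] x; first by rewrite !big_ord0.
rewrite big_ord_recr big_ord_recl fM IH; congr (f (x _) * _).
  by apply: val_inj; rewrite /= subn1.
by apply: eq_bigr => s _; congr (f (x _)); apply: val_inj; rewrite /= subSS.
Qed.

End ReversedWords.

Section FixedVectorRelations.
Variables (R : realType) (n p : nat).
Local Notation C := R[i].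
Local Notation idx := {ffun 'I_p -> 'I_n}.

Definition multi_entry (A : pzRingType) (v : 'I_n -> 'I_n -> A) (i j : idx) : A :=
  \prod_s v (i s) (j s).

(* Vanishes for all i iff the p-th tensor power of the matrix v fixes xi. *)
Definition fix_defect (A : lalgType C) (v : 'I_n -> 'I_n -> A) (xi : idx -> C)
    (i : idx) : A :=
  \sum_j xi j *: multi_entry v i j - xi i *: 1.

Lemma eq_fix_defect (A : lalgType C) (v w : 'I_n -> 'I_n -> A) xi i :
  (forall x y, v x y = w x y) -> fix_defect v xi i = fix_defect w xi i.
Proof.
by move=> vw; rewrite (_ : v = w) //; apply/funext => x; apply/funext => y.
Qed.

Lemma fix_defect_morph (A B : lalgType C) (f : A -> B) v xi i :
  (forall a b, f (a + b) = f a + f b) -> (forall c a, f (c *: a) = c *: f a) ->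
  (forall a b, f (a * b) = f a * f b) -> f 1 = 1 ->
  f (fix_defect v xi i) = fix_defect (fun x y => f (v x y)) xi i.
Proof.
move=> fD fZ fM f1; have f0 : f 0 = 0 by rewrite -(scale0r (0 : A)) fZ scale0r.
rewrite /fix_defect -![- (_ *: _)]scaleN1r fD !fZ f1 (big_morph f fD f0).
by congr (_ + _); apply: eq_bigr => j _; rewrite fZ /multi_entry (big_morph f fM f1).
Qed.

(** The reversed vector satisfies a relation of the same shape, which makes the family of all such
    relations stable under the star and the antipode. *)
Lemma fix_defect_anti (A B : lalgType C) (s : {rmorphism C -> C}) (f : A -> B) v xi i :
  (forall a b, f (a + b) = f a + f b) -> (forall c a, f (c *: a) = s c *: f a) ->
  (forall a b, f (a * b) = f b * f a) -> f 1 = 1 ->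
  f (fix_defect v xi i)
    = fix_defect (fun x y => f (v x y)) (fun j => s (xi (rev_idx j))) (rev_idx i).
Proof.
move=> fD fZ fM f1; have f0 : f 0 = 0 by rewrite -(scale0r (0 : A)) fZ rmorph0 scale0r.
rewrite /fix_defect -![- (_ *: _)]scaleN1r fD !fZ rmorphN1 f1 (big_morph f fD f0) rev_idxK.
congr (_ + _); rewrite big_rev_idx; apply: eq_bigr => j _.
rewrite fZ /multi_entry (anti_prod _ f1 fM); congr (_ *: _).
by apply: eq_bigr => k _; rewrite !ffunE rev_ordK.
Qed.

Variables (F F2 : lalgType C) (t : F -> F -> F2).
Hypothesis tM : forall a b a' b', t a b * t a' b' = t (a * a') (b * b').
Hypothesis t11 : t 1 1 = 1.
Hypothesis tDl : forall a a' b, t (a + a') b = t a b + t a' b.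
Hypothesis tDr : forall a b b', t a (b + b') = t a b + t a b'.
Hypothesis tZl : forall c a b, t (c *: a) b = c *: t a b.
Hypothesis tZr : forall c a b, t a (c *: b) = c *: t a b.

Let t0l b : t 0 b = 0. Proof. by rewrite -(scale0r (0 : F)) tZl scale0r. Qed.
Let t0r b : t b 0 = 0. Proof. by rewrite -(scale0r (0 : F)) tZr scale0r. Qed.
Let tNl a b : t (- a) b = - t a b. Proof. by rewrite -scaleN1r tZl scaleN1r. Qed.
Let tNr a b : t a (- b) = - t a b. Proof. by rewrite -scaleN1r tZr scaleN1r. Qed.
Let t_suml I r (P : pred I) f b :
  t (\sum_(i <- r | P i) f i) b = \sum_(i <- r | P i) t (f i) b.
Proof. exact: (big_morph (t^~ b) (fun x y => tDl x y b) (t0l b)). Qed.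
Let t_sumr I r (P : pred I) f a :
  t a (\sum_(i <- r | P i) f i) = \sum_(i <- r | P i) t a (f i).
Proof. exact: (big_morph (t a) (tDr a) (t0r a)). Qed.

(** Tensor powers of a corepresentation are corepresentations: distributing the product over the
    sums in [k] gives one sum over multi-indices. *)
Lemma multi_entry_comul (v w : 'I_n -> 'I_n -> F) i j :
  multi_entry (fun x y => \sum_k t (v x k) (w k y)) i j
    = \sum_k t (multi_entry v i k) (multi_entry w k j).
Proof.
rewrite /multi_entry bigA_distr_bigA /=; apply: eq_bigr => k _.
by elim/big_rec3 : _ => [|s a b u _ ->]; rewrite ?t11 ?tM.
Qed.

Lemma multi_entry_tr_comul (v w : 'I_n -> 'I_n -> F) i j :
  multi_entry (fun x y => \sum_k t (v k y) (w x k)) i j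
    = \sum_k t (multi_entry v k j) (multi_entry w i k).
Proof.
rewrite /multi_entry bigA_distr_bigA /=; apply: eq_bigr => k _.
by elim/big_rec3 : _ => [|s a b u _ ->]; rewrite ?t11 ?tM.
Qed.

(** Inserting the terms xi_k u_ik (x) 1 telescopes the defect of a product of matrices. Every
    summand then has a defect in one of its legs, which is what a coideal requires. *)
Lemma fix_defect_comul (v : 'I_n -> 'I_n -> F) xi i :
  fix_defect (fun x y => \sum_k t (v x k) (v k y)) xi i
    = \sum_k t (multi_entry v i k) (fix_defect v xi k) + t (fix_defect v xi i) 1.
Proof.
rewrite /fix_defect tDl tNl tZl t11 t_suml addrA; congr (_ - _).
rewrite -big_split /=; under eq_bigr do rewrite multi_entry_comul scaler_sumr.
rewrite exchange_big /=; apply: eq_bigr => k _.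
rewrite tDr tNr tZr tZl subrK t_sumr.
by apply: eq_bigr => j _; rewrite tZr.
Qed.

(** The transpose of u is comultiplied with the two legs exchanged; the telescoping is the same. *)
Lemma fix_defect_tr_comul (v : 'I_n -> 'I_n -> F) xi i :
  fix_defect (fun x y => \sum_k t (v k y) (v x k)) xi i
    = \sum_k t (fix_defect v xi k) (multi_entry v i k) + t 1 (fix_defect v xi i).
Proof.
rewrite /fix_defect tDr tNr tZr t11 t_sumr addrA; congr (_ - _).
rewrite -big_split /=; under eq_bigr do rewrite multi_entry_tr_comul scaler_sumr.
rewrite exchange_big /=; apply: eq_bigr => k _.
rewrite tDl tNl tZl tZr subrK t_suml.
by apply: eq_bigr => j _; rewrite tZl.
Qed.

End FixedVectorRelations.

Section FreeHopfOperations.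
Variables (R : realType) (n : nat).
Local Notation C := R[i].
Local Notation F := (freeAlg R n).
Local Notation F2 := (freeAlg2 R n).

Lemma comulD (a b : F) : comul (a + b) = comul a + comul b.
Proof. exact: free_evalD. Qed.

Lemma comulZ c (a : F) : comul (c *: a) = c *: comul a.
Proof. exact: free_evalZ. Qed.

Lemma comulM (a b : F) : comul (a * b) = comul a * comul b.
Proof. exact: (free_evalM _ (@malg_scalerAr R (word n * word n)%type)). Qed.

Lemma comul1 : comul 1 = 1 :> F2.
Proof. exact: free_eval1. Qed.

Lemma comul_letter i j :
  comul (letter R i j) = \sum_k tens (letter R i k) (letter R k j) :> F2.
Proof. exact: free_eval_letter. Qed.

Lemma regular_scaleAr c (x y : C^o) : c *: (x * y) = x * (c *: y).
Proof. exact: mulrCA. Qed.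

Lemma counitD (a b : F) : counit (a + b) = counit a + counit b.
Proof. exact: free_evalD. Qed.

Lemma counitZ c (a : F) : counit (c *: a) = c * counit a.
Proof. exact: free_evalZ. Qed.

Lemma counitM (a b : F) : counit (a * b) = counit a * counit b.
Proof. exact: (free_evalM _ regular_scaleAr). Qed.

Lemma counit1 : @counit R n 1 = 1.
Proof. exact: (@free_eval1 R n C^o). Qed.

Lemma counit_letter (i j : 'I_n) : counit (letter R i j) = (i == j)%:R :> C.
Proof. exact: (@free_eval_letter R n C^o). Qed.

Lemma antipodeE : @antipode R n =
  semilin_ext idfun (fun w : word n => \prod_(g <- rev (w : seq _)) letter R g.2 g.1).
Proof. by []. Qed.

Lemma antipodeD (a b : F) : antipode (a + b) = antipode a + antipode b.
Proof. exact: (semilin_extD idfun). Qed.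

Lemma antipodeZ c (a : F) : antipode (c *: a) = c *: antipode a.
Proof. exact: (semilin_extZ idfun). Qed.

Lemma antipodeM (a b : F) : antipode (a * b) = antipode b * antipode a.
Proof.
apply: (semilin_ext_anti idfun (@malg_scalerAr R (word n))) => w w'.
by rewrite fmM rev_cat big_cat.
Qed.

Lemma antipode1 : antipode 1 = 1 :> F.
Proof. by apply: (semilin_ext1 idfun); rewrite fm1 big_nil. Qed.

Lemma antipode_letter (i j : 'I_n) : antipode (letter R i j) = letter R j i.
Proof. by rewrite antipodeE semilin_extU scale1r fmU big_seq1. Qed.

Lemma starE : @star R n = semilin_ext Num.conj
  (fun w : word n => \prod_(g <- rev (w : seq _)) letter R g.1 g.2).
Proof. by []. Qed.

Lemma starD (a b : F) : star (a + b) = star a + star b.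
Proof. by rewrite starE semilin_extD. Qed.

Lemma starZ c (a : F) : star (c *: a) = c^* *: star a.
Proof. by rewrite starE semilin_extZ. Qed.

Lemma starM (a b : F) : star (a * b) = star b * star a.
Proof.
rewrite starE; apply: (semilin_ext_anti Num.conj (@malg_scalerAr R (word n))) => w w'.
by rewrite fmM rev_cat big_cat.
Qed.

Lemma star1 : star 1 = 1 :> F.
Proof. by rewrite starE; apply: (semilin_ext1 Num.conj); rewrite fm1 big_nil. Qed.

Lemma star_letter (i j : 'I_n) : star (letter R i j) = letter R i j.
Proof. by rewrite starE semilin_extU rmorph1 scale1r fmU big_seq1. Qed.

Lemma free_anti_eq (A : lalgType C) (s : {rmorphism C -> C}) (f g : F -> A) :
  (forall a b, f (a + b) = f a + f b) -> (forall c a, f (c *: a) = s c *: f a) ->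
  (forall a b, f (a * b) = f b * f a) -> f 1 = 1 ->
  (forall a b, g (a + b) = g a + g b) -> (forall c a, g (c *: a) = s c *: g a) ->
  (forall a b, g (a * b) = g b * g a) -> g 1 = 1 ->
  (forall i j, f (letter R i j) = g (letter R i j)) -> f =1 g.
Proof.
move=> fD fZ fM f1 gD gZ gM g1 fg a.
elim/free_ind: a => [||a b IHa IHb|c a IH|i j a IH].
- by rewrite -(scale0r (1 : F)) fZ gZ f1 g1.
- by rewrite f1 g1.
- by rewrite fD gD IHa IHb.
- by rewrite fZ gZ IH.
- by rewrite fM gM IH fg.
Qed.

End FreeHopfOperations.

(** * Hopf operations in the Hadamard model and maximality of the ideal *)

Section HadamardModel.
Variables (R : realType) (n : nat) (H : 'M[R[i]]_n.+1).
Hypothesis H_unit : forall x y, `|H x y| = 1.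
Local Notation C := R[i].
Local Notation F := (freeAlg R n.+1).
Local Notation P := (@hadamard_proj R n.+1 H : 'I_n.+1 -> 'I_n.+1 -> 'M[C]_n.+1).

Definition adjmx m (A : 'M[C]_m) : 'M[C]_m := (map_mx Num.conj A)^T.

(** For a positive size the matrices form a nontrivial ring, so that the lemmas on [free_eval] apply
    to the model. *)
Lemma hadamard_repE a : hadamard_rep H a = free_eval P a.
Proof. by []. Qed.

Lemma matrix_scaleAr m c (A B : 'M[C]_m.+1) : c *: (A * B) = A * (c *: B).
Proof. exact: scalerAr. Qed.

Lemma hadamard_repD a b :
  hadamard_rep H (a + b) = hadamard_rep H a + hadamard_rep H b.
Proof. by rewrite !hadamard_repE free_evalD. Qed.

Lemma hadamard_repZ c a : hadamard_rep H (c *: a) = c *: hadamard_rep H a.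
Proof. by rewrite !hadamard_repE free_evalZ. Qed.

Lemma hadamard_repM a b :
  hadamard_rep H (a * b) = hadamard_rep H a * hadamard_rep H b.
Proof. by rewrite !hadamard_repE (free_evalM _ (@matrix_scaleAr n)). Qed.

Lemma hadamard_rep1 : hadamard_rep H 1 = 1.
Proof. by rewrite !hadamard_repE free_eval1. Qed.

Lemma hadamard_rep_letter i j : hadamard_rep H (letter R i j) = P i j.
Proof. by rewrite !hadamard_repE free_eval_letter. Qed.

Lemma unit_conj (z : C) : `|z| = 1 -> z^* = z^-1.
Proof. by move=> z1; rewrite invC_norm z1 expr1n invr1 mul1r. Qed.

(** Unimodular entries turn conjugates into inverses and the squared norm of a quotient of rows into
    the size, leaving a purely multiplicative expression. *)
Lemma hadamard_projE i j k l :
  P i j k l = H i k / H j k * (H j l / H i l) / n.+1%:R.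
Proof.
rewrite mxE (eq_bigr (fun=> 1)) => [|m _]; last by rewrite normf_div !H_unit divr1 expr1n.
have conjH x y : (H x y)^* = (H x y)^-1 by exact: unit_conj.
have -> : (H i l / H j l)^* = H j l / H i l.
  by rewrite fmorph_div /= 2!conjH invrK mulrC.
by rewrite sumr_const card_ord.
Qed.

Lemma hadamard_projT i j : (P i j)^T = P j i.
Proof.
apply/matrixP => k l; rewrite mxE !hadamard_projE; congr (_ / _).
by rewrite mulrC.
Qed.

Lemma hadamard_proj_adj i j : adjmx (P i j) = P i j.
Proof.
apply/matrixP => k l; rewrite !mxE fmorph_div rmorphM /= conjCK [_^* * _]mulrC.
congr (_ / _); apply: conj_Creal.
by apply: rpred_sum => m _; rewrite rpredX // normr_real.
Qed.

Lemma trmxD m (A B : 'M[C]_m) : (A + B)^T = A^T + B^T.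
Proof. exact: linearD. Qed.

Lemma trmxZ m c (A : 'M[C]_m) : (c *: A)^T = c *: A^T.
Proof. exact: linearZ. Qed.

Lemma trmx_mulr m (A B : 'M[C]_m.+1) : (A * B)^T = B^T * A^T.
Proof. exact: trmx_mul. Qed.

(** Transposition implements the antipode because it exchanges the projections at (i, j) and (j, i).
    Thus the kernel of the model is stable under the antipode. *)
Lemma hadamard_rep_antipode a : hadamard_rep H (antipode a) = (hadamard_rep H a)^T.
Proof.
move: a; apply: (free_anti_eq (s := idfun)) => [a b|c a|a b||a b|c a|a b||i j].
- by rewrite antipodeD hadamard_repD.
- by rewrite antipodeZ hadamard_repZ.
- by rewrite antipodeM; exact: hadamard_repM.
- by rewrite antipode1 hadamard_rep1.
- by rewrite hadamard_repD trmxD.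
- by rewrite hadamard_repZ trmxZ.
- by rewrite hadamard_repM trmx_mulr.
- by rewrite hadamard_rep1 trmx1.
- by rewrite antipode_letter !hadamard_rep_letter hadamard_projT.
Qed.

Lemma adjmxM m (A B : 'M[C]_m) : adjmx (A *m B) = adjmx B *m adjmx A.
Proof. by rewrite /adjmx map_mxM trmx_mul. Qed.

Lemma adjmx_mulr m (A B : 'M[C]_m.+1) : adjmx (A * B) = adjmx B * adjmx A.
Proof. exact: adjmxM. Qed.

Lemma adjmxD m (A B : 'M[C]_m) : adjmx (A + B) = adjmx A + adjmx B.
Proof. by rewrite /adjmx map_mxD trmxD. Qed.

Lemma adjmxZ m c (A : 'M[C]_m) : adjmx (c *: A) = (c^*) *: adjmx A.
Proof. by rewrite /adjmx map_mxZ trmxZ. Qed.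

Lemma adjmxK m : involutive (@adjmx m).
Proof. by move=> A; apply/matrixP => i j; rewrite !mxE conjCK. Qed.

Lemma adjmx1 m : adjmx (1%:M : 'M[C]_m) = 1%:M.
Proof. by rewrite /adjmx map_mx1 trmx1. Qed.

Lemma hadamard_rep_star a : hadamard_rep H (star a) = adjmx (hadamard_rep H a).
Proof.
move: a; apply: (free_anti_eq (s := Num.conj)) => [a b|c a|a b||a b|c a|a b||i j].
- by rewrite starD hadamard_repD.
- by rewrite starZ hadamard_repZ.
- by rewrite starM; exact: hadamard_repM.
- by rewrite star1 hadamard_rep1.
- by rewrite hadamard_repD adjmxD.
- by rewrite hadamard_repZ adjmxZ.
- by rewrite hadamard_repM adjmx_mulr.
- by rewrite hadamard_rep1 adjmx1.
- by rewrite star_letter hadamard_rep_letter hadamard_proj_adj.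
Qed.

(** The way to prove relations in C(G): relations that hold in the model, and that the Hopf
    operations preserve modulo the enlarged ideal, can be adjoined to [J]; maximality then puts the
    enlarged ideal back inside [J]. *)
Lemma largest_hopf_ideal_absorbs (J X : set F) :
  is_largest_hopf_ideal H J ->
  let I := ideal_span (J `|` X) in
  (forall x, X x -> hadamard_rep H x = 0) ->
  (forall x, X x -> tensor_ideal (@tens R n.+1) I (comul x)) ->
  (forall x, X x -> counit x = 0) ->
  (forall x, X x -> I (star x)) -> (forall x, X x -> I (antipode x)) ->
  X `<=` J.
Proof.
move=> [hopfJ Jker maxJ] I Xker Xcomul Xcounit Xstar Xantipode.
have JI x : J x -> I x by move=> Jx; apply: ideal_span_in; left.
have hopfI : is_hopf_star_ideal I.
  split.
  - by move=> x /(hopf_ideal_magic hopfJ)/JI.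
  - exact: ideal_spanD.
  - by move=> a x b; exact: ideal_spanM.
  - apply: ideal_span_anti (@starD R n.+1) (@starM R n.+1) _ => x [|/Xstar//].
    by move=> /(hopf_ideal_star hopfJ)/JI.
  - apply: (ideal_span_comul (@tensM R n.+1) (@tens_ind R n.+1) (@comulD R n.+1)
      (@comulM R n.+1)) => x [|/Xcomul//].
    move=> /(hopf_ideal_comul hopfJ)[s [Js xE]]; exists s; split=> // p /Js[]Jp.
      by left; exact: JI.
    by right; exact: JI.
  - apply: (ideal_span_ker (@counitD R n.+1) (@counitM R n.+1)) => x [|/Xcounit//].
    exact: hopf_ideal_counit.
  - apply: ideal_span_anti (@antipodeD R n.+1) (@antipodeM R n.+1) _ => x [|/Xantipode//].
    by move=> /(hopf_ideal_antipode hopfJ)/JI.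
move=> x Xx; apply: (maxJ I hopfI); last by apply: ideal_span_in; right.
by apply: (ideal_span_ker hadamard_repD hadamard_repM) => y [/Jker|/Xker].
Qed.

End HadamardModel.

Section FixedVectorsInIdeal.
Variables (R : realType) (n : nat) (H : 'M[R[i]]_n.+1).
Hypothesis H_unit : forall x y, `|H x y| = 1.
Local Notation C := R[i].
Local Notation F := (freeAlg R n.+1).
Local Notation P := (@hadamard_proj R n.+1 H : 'I_n.+1 -> 'I_n.+1 -> 'M[C]_n.+1).
Variable p : nat.
Local Notation idx := {ffun 'I_p -> 'I_n.+1}.

Definition letter_tr (b : bool) (x y : 'I_n.+1) : F :=
  if b then letter R y x else letter R x y.

(* The antipode exchanges the fixed vector relations of u with those of its
   transpose; including both kinds makes the ideal stable under the antipode without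
   using that the projections in a row or a column are orthogonal. *)
Definition model_relation : set F :=
  [set x | exists b (xi : idx -> C) i, x = fix_defect (letter_tr b) xi i /\
     forall j, hadamard_rep H (fix_defect (letter_tr b) xi j) = 0].

Lemma antipode_fix_defect b (xi : idx -> C) i :
  antipode (fix_defect (letter_tr b) xi i)
    = fix_defect (letter_tr (~~ b)) (fun j => xi (rev_idx j)) (rev_idx i).
Proof.
rewrite (fix_defect_anti (s := idfun) _ _ _ (@antipodeD R n.+1) (@antipodeZ R n.+1)
  (@antipodeM R n.+1) (@antipode1 R n.+1)).
apply: eq_fix_defect => x y.
by rewrite /letter_tr; case: b; rewrite antipode_letter.
Qed.

Lemma star_fix_defect b (xi : idx -> C) i :
  star (fix_defect (letter_tr b) xi i)
    = fix_defect (letter_tr b) (fun j => (xi (rev_idx j))^*) (rev_idx i).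
Proof.
rewrite (fix_defect_anti (s := Num.conj) _ _ _ (@starD R n.+1) (@starZ R n.+1)
  (@starM R n.+1) (@star1 R n.+1)).
apply: eq_fix_defect => x y.
by rewrite /letter_tr; case: b; rewrite star_letter.
Qed.

(** This is where the minimality of G enters: whatever the model fixes is already fixed by u in
    C(G). *)
Lemma model_relation_sub (J : set F) :
  is_largest_hopf_ideal H J -> model_relation `<=` J.
Proof.
move=> Jmax; apply: (largest_hopf_ideal_absorbs Jmax) => x [b [xi [i [-> ker]]]].
- exact: ker.
- have XI j : ideal_span (J `|` model_relation) (fix_defect (letter_tr b) xi j).
    by apply: ideal_span_in; right; exists b, xi, j.
  rewrite (fix_defect_morph _ _ _ (@comulD R n.+1) (@comulZ R n.+1)
    (@comulM R n.+1) (@comul1 R n.+1)).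
  case: b ker XI => ker XI.
    have -> : (fun x y => comul (letter_tr true x y)) =
        (fun x y => \sum_k tens (letter_tr true k y) (letter_tr true x k)).
      by apply/funext => y; apply/funext => z; rewrite /letter_tr comul_letter.
    rewrite (fix_defect_tr_comul (@tensM R n.+1) (@tens11 R n.+1) (@tensDl R n.+1)
      (@tensDr R n.+1) (@tensZl R n.+1) (@tensZr R n.+1)).
    apply: tensor_idealD; last by apply: tensor_ideal_in; right.
    by apply: tensor_ideal_sum => k _; apply: tensor_ideal_in; left.
  have -> : (fun x y => comul (letter_tr false x y)) =
      (fun x y => \sum_k tens (letter_tr false x k) (letter_tr false k y)).
    by apply/funext => y; apply/funext => z; rewrite /letter_tr comul_letter.
  rewrite (fix_defect_comul (@tensM R n.+1) (@tens11 R n.+1) (@tensDl R n.+1)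
    (@tensDr R n.+1) (@tensZl R n.+1) (@tensZr R n.+1)).
  apply: tensor_idealD; last by apply: tensor_ideal_in; left.
  by apply: tensor_ideal_sum => k _; apply: tensor_ideal_in; right.
(* The counit of a multi-entry is a Kronecker delta: only j = i survives, and it cancels against the
   subtracted term. *)
- rewrite (fix_defect_morph (B := C^o) _ _ _ (@counitD R n.+1) (@counitZ R n.+1)
    (@counitM R n.+1) (@counit1 R n.+1)).
  rewrite /fix_defect (bigD1 i) //= big1 ?addr0 => [|j ji].
    rewrite /multi_entry big1 ?subrr // => s _.
    by rewrite /letter_tr; case: b {ker}; rewrite counit_letter eqxx.
  have [s sji] : exists s, j s != i s.
    by apply/existsP; apply: contraR ji; rewrite negb_exists => /forallP ij;
      apply/eqP/ffunP => s; apply/eqP; rewrite -[_ == _]negbK.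
  rewrite /multi_entry (bigD1 s) //= (_ : counit _ = 0) ?mul0r ?scaler0 //.
  rewrite /letter_tr; case: b {ker}; rewrite counit_letter ?(negPf sji) //.
  by rewrite eq_sym (negPf sji).
- apply: ideal_span_in; right; exists b, (fun j => (xi (rev_idx j))^*), (rev_idx i).
  split; first exact: star_fix_defect.
  (* As j is itself a reversed index, its defect is the star of a defect of [xi], which the model
     kills. *)
  move=> j; rewrite -[j]rev_idxK -star_fix_defect hadamard_rep_star ker.
  by rewrite /adjmx map_mx0 trmx0.
- apply: ideal_span_in; right; exists (~~ b), (fun j => xi (rev_idx j)), (rev_idx i).
  split; first exact: antipode_fix_defect.
  move=> j; rewrite -[j]rev_idxK -antipode_fix_defect (hadamard_rep_antipode H_unit) ker.
  exact: trmx0.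
Qed.

Lemma hadamard_rep_fix_defect (xi : idx -> C) i :
  hadamard_rep H (fix_defect (letter_tr false) xi i) = fix_defect P xi i.
Proof.
rewrite (fix_defect_morph _ _ _ (@hadamard_repD R n H) (@hadamard_repZ R n H)
  (@hadamard_repM R n H) (@hadamard_rep1 R n H)).
apply: eq_fix_defect => x y.
exact: hadamard_rep_letter.
Qed.

Variables (G : hadamard_qgroup H) (h : {scalar G}) (h_haar : is_haar h).
Local Notation u := (@qg_coord R n.+1 H G).

Definition haar_moment (i j : idx) : C := h (multi_entry u i j).

Lemma eval_fix_defect (xi : idx -> C) i :
  free_eval u (fix_defect (letter_tr false) xi i) = fix_defect u xi i.
Proof.
rewrite (fix_defect_morph _ _ _ (free_evalD u) (free_evalZ u)
  (free_evalM u (@scalerAr _ G)) (free_eval1 u)).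
apply: eq_fix_defect => x y.
exact: free_eval_letter.
Qed.

(** Apply [h] to the relation u xi = xi, which holds in C(G) by maximality. *)
Lemma haar_moment_fix (xi : idx -> C) : (forall i, fix_defect P xi i = 0) ->
  forall i, \sum_j haar_moment i j * xi j = xi i.
Proof.
move=> fixP i.
have : fix_defect u xi i = 0.
  rewrite -eval_fix_defect.
  have Jx : qg_ideal G (fix_defect (letter_tr false) xi i).
    apply: (model_relation_sub (qg_ideal_largest G)); exists false, xi, i.
    by split=> // j; rewrite hadamard_rep_fix_defect.
  exact: (qg_coord_rel Jx).
move=> /(congr1 h) /eqP; rewrite /fix_defect linearB linear0 linearZ /= (haar1 h_haar).
rewrite mulr1 subr_eq0 linear_sum => /eqP <-.
by apply: eq_bigr => j _; rewrite linearZ /= mulrC.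
Qed.

(** Right invariance evaluated at a product of coordinates: the comultiplication puts u_ik in the
    first leg and u_kj under [h]. *)
Lemma haar_moment_invariant i j : fix_defect u (haar_moment^~ j) i = 0.
Proof.
(* [haar_right] is stated through basis words; this evaluates the same functional on arbitrary
   elementary tensors. *)
have lin_tens (a b : F) :
    lin_ext (fun q : (word n.+1 * word n.+1)%type =>
      h (word_prod u q.2) *: word_prod u q.1) (tens a b)
    = h (free_eval u b) *: free_eval u a.
  rewrite -[LHS]/(semilin_ext idfun _ _) semilin_ext_tens.
  rewrite -[free_eval u a]/(semilin_ext idfun _ _) -semilin_ext_funZ.
  apply: eq_semilin_ext => w /=; rewrite -[free_eval u b]/(semilin_ext idfun _ _).
  rewrite /semilin_ext linear_sum scaler_suml.
  by apply: eq_bigr => z _; rewrite [h (_ *: _)]linearZ /= !scalerA mulrC.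
have eval_entry k l : free_eval u (multi_entry (letter_tr false) k l) = multi_entry u k l.
  rewrite /multi_entry (big_morph _ (free_evalM u (@scalerAr _ G)) (free_eval1 u)).
  by apply: eq_bigr => s _; rewrite /letter_tr free_eval_letter.
have := haar_right h_haar (multi_entry (letter_tr false) i j).
rewrite {1}/multi_entry (big_morph _ (@comulM R n.+1) (@comul1 R n.+1)).
have -> : \prod_s comul (letter_tr false (i s) (j s)) = \sum_(k : idx)
    tens (multi_entry (letter_tr false) i k) (multi_entry (letter_tr false) k j).
  rewrite -(multi_entry_comul (@tensM R n.+1) (@tens11 R n.+1)).
  by apply: eq_bigr => s _; rewrite /letter_tr comul_letter.
rewrite -[LHS]/(semilin_ext idfun _ _) semilin_ext_sum /fix_defect => haar.
apply/eqP; rewrite subr_eq0; apply/eqP; rewrite /haar_moment -eval_entry -haar.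
by apply: eq_bigr => k _; rewrite [RHS]lin_tens !eval_entry.
Qed.

End FixedVectorsInIdeal.

(** * The C*-algebra of matrices *)

Section OperatorNorm.
Variable R : realType.
Local Notation C := R[i].

(** The C*-norm takes values in [R], whereas the modulus of a complex number lies in [C]. *)
Definition absC (z : C) : R := complex.Re `|z|.

Lemma absCE z : (absC z)%:C%C = `|z|.
Proof. exact: RRe_real (normr_real z). Qed.

Lemma absC_ge0 z : 0 <= absC z.
Proof. by rewrite -lecR absCE normr_ge0. Qed.

Lemma absCM z w : absC (z * w) = absC z * absC w.
Proof. by apply: complexI; rewrite rmorphM !absCE normrM. Qed.

Lemma absCD z w : absC (z + w) <= absC z + absC w.
Proof. by rewrite -lecR rmorphD !absCE ler_normD. Qed.

Lemma absC0 : absC 0 = 0.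
Proof. by apply: complexI; rewrite absCE normr0. Qed.

Lemma absC_eq0 z : absC z = 0 -> z = 0.
Proof. by move=> z0; apply/eqP; rewrite -normr_eq0 -absCE z0. Qed.

Lemma absC_sum I (r : seq I) (P : pred I) (f : I -> C) :
  absC (\sum_(i <- r | P i) f i) <= \sum_(i <- r | P i) absC (f i).
Proof.
elim/big_rec2 : _ => [|i x y _ IH]; first by rewrite absC0.
by rewrite (le_trans (absCD _ _)) // lerD2l.
Qed.

Lemma absC_Re z : `|complex.Re z| <= absC z.
Proof.
by rewrite /absC normc_def /= -sqrtr_sqr ler_wsqrtr // lerDl sqr_ge0.
Qed.

Lemma absC_Im z : `|complex.Im z| <= absC z.
Proof.
by rewrite /absC normc_def /= -sqrtr_sqr ler_wsqrtr // lerDr sqr_ge0.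
Qed.

Lemma absC_le_ReIm z : absC z <= `|complex.Re z| + `|complex.Im z|.
Proof.
have ReIm_ge0 : 0 <= `|complex.Re z| + `|complex.Im z| by rewrite addr_ge0.
rewrite /absC normc_def /= -(ger0_norm ReIm_ge0) -sqrtr_sqr ler_wsqrtr //.
rewrite sqrrD !real_normK ?num_real // -addrAC lerDl.
by rewrite mulrn_wge0 // mulr_ge0.
Qed.

Lemma real_leD (a b c : R) (x y z : C) :
  a%:C%C = x -> b%:C%C = y -> c%:C%C = z -> x <= y + z -> a <= b + c.
Proof. by move=> <- <- <-; rewrite -rmorphD lecR. Qed.

Lemma real_leM (a b c : R) (x y z : C) :
  a%:C%C = x -> b%:C%C = y -> c%:C%C = z -> x <= y * z -> a <= b * c.
Proof. by move=> <- <- <-; rewrite -rmorphM lecR. Qed.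

Lemma real_cauchy_cvg (u : nat -> R) :
  (forall e : R, 0 < e -> exists m, forall p q,
     (m <= p)%N -> (m <= q)%N -> `|u p - u q| < e) ->
  exists l : R, forall e : R, 0 < e -> exists m, forall p,
    (m <= p)%N -> `|u p - l| < e.
Proof.
move=> u_cauchy.
have /cvg_ex[l ul] : cvgn u.
  apply: cauchy_cvg; apply: cauchy_exP => e e0.
  have [m um] := u_cauchy _ e0; exists (u m); exists m => //= p mp.
  by rewrite -ball_normE /=; exact: um.
exists l => e e0; have /cvgrPdist_lt/(_ _ e0)[m _ lm] := ul.
by exists m => p mp; rewrite distrC; exact: lm.
Qed.

Lemma complex_cauchy_cvg (u : nat -> C) :
  (forall e : R, 0 < e -> exists m, forall p q,
     (m <= p)%N -> (m <= q)%N -> absC (u p - u q) < e) ->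
  exists l : C, forall e : R, 0 < e -> exists m, forall p,
    (m <= p)%N -> absC (u p - l) < e.
Proof.
move=> u_cauchy.
have [|a ua] := @real_cauchy_cvg (fun k => complex.Re (u k)).
  move=> e /u_cauchy[m um]; exists m => p q mp mq.
  by rewrite (le_lt_trans _ (um p q mp mq)) // -raddfB absC_Re.
have [|b ub] := @real_cauchy_cvg (fun k => complex.Im (u k)).
  move=> e /u_cauchy[m um]; exists m => p q mp mq.
  by rewrite (le_lt_trans _ (um p q mp mq)) // -raddfB absC_Im.
exists (a +i* b)%C => e e0; have e20 : 0 < e / 2 by rewrite divr_gt0.
have [m um] := ua _ e20; have [m' um'] := ub _ e20.
exists (maxn m m') => p; rewrite geq_max => /andP[mp mp'].
rewrite (le_lt_trans (absC_le_ReIm _)) // [ltRHS]splitr.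
by rewrite (raddfB (@complex.Re R)) (raddfB (@complex.Im R)) ltrD ?um ?um'.
Qed.

Definition vnorm m (x : 'rV[C]_m) : R := complex.Re (sqrtC (dotmx x x)).

Section Vector.
Variable m : nat.
Implicit Types x y : 'rV[C]_m.

Lemma vnormE x : (vnorm x)%:C%C = sqrtC (dotmx x x).
Proof. by rewrite RRe_real // ger0_real // sqrt_dnorm_ge0. Qed.

Lemma vnorm_ge0 x : 0 <= vnorm x.
Proof. by rewrite -lecR vnormE sqrt_dnorm_ge0. Qed.

Lemma vnorm_eq0 x : vnorm x = 0 -> x = 0.
Proof. by move=> x0; apply/eqP; rewrite -(sqrt_dnorm_eq0 (@dotmx C m)) -vnormE x0. Qed.

Lemma vnorm0 : vnorm (0 : 'rV[C]_m) = 0.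
Proof. by apply: complexI; rewrite vnormE linear0l sqrtC0. Qed.

Lemma vnormD x y : vnorm (x + y) <= vnorm x + vnorm y.
Proof.
have [le_xy _] := triangle_lerif (@dotmx C m) x y.
exact: (real_leD (vnormE _) (vnormE _) (vnormE _) le_xy).
Qed.

Lemma vnormZ c x : vnorm (c *: x) = absC c * vnorm x.
Proof.
apply: complexI; rewrite rmorphM /= absCE !vnormE dnormZ sqrtCM ?sqrCK //.
- by rewrite nnegrE exprn_ge0.
- by rewrite nnegrE dnorm_ge0.
Qed.

Lemma vnorm_sqr x : (vnorm x ^+ 2)%:C%C = dotmx x x.
Proof. by rewrite rmorphXn /= vnormE sqrtCK. Qed.

Lemma dotmx_sum x y : dotmx x y = \sum_i x 0 i * (y 0 i)^*.
Proof. by rewrite dotmxE mxE; apply: eq_bigr => i _; rewrite !mxE. Qed.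

Lemma vnorm_coord x i : absC (x 0 i) <= vnorm x.
Proof.
rewrite -(ler_pXn2r (n := 2)) ?nnegrE ?absC_ge0 ?vnorm_ge0 // -lecR vnorm_sqr.
rewrite rmorphXn /= absCE dotmx_sum (bigD1 i) //= normCK lerDl sumr_ge0 // => j _.
exact: mul_conjC_ge0.
Qed.

Lemma vnorm_delta i : vnorm (delta_mx 0 i : 'rV[C]_m) = 1.
Proof.
apply: complexI; rewrite vnormE dotmx_sum (bigD1 i) //= big1 => [|j ji].
  by rewrite !mxE !eqxx mul1r addr0 rmorph1 sqrtC1.
by rewrite !mxE (negPf ji) mul0r.
Qed.

Lemma vnorm_le_sum x : vnorm x <= \sum_i absC (x 0 i).
Proof.
rewrite [x in vnorm x]row_sum_delta; elim/big_rec2 : _ => [|i a b _ IH].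
  by rewrite vnorm0.
by rewrite (le_trans (vnormD _ _)) // vnormZ vnorm_delta mulr1 lerD2l.
Qed.

End Vector.

(** Cauchy-Schwarz for the scalar product of x A A^* with x, which equals the squared norm of x A;
    the C*-identity rests on it. *)
Lemma vnorm_mul_sqr m k (x : 'rV[C]_m) (A : 'M[C]_(m, k)) :
  vnorm (x *m A) ^+ 2 <= vnorm (x *m A *m (map_mx Num.conj A)^T) * vnorm x.
Proof.
set y := x *m A *m _.
have yx : ((vnorm (x *m A)) ^+ 2)%:C%C = `|dotmx y x|.
  have <- : dotmx (x *m A) (x *m A) = dotmx y x.
    by rewrite /y !dotmxE trmx_mul map_mxM map_trmx !mulmxA.
  by rewrite -vnorm_sqr ger0_norm // ler0c sqr_ge0.
have [le_yx _] := CauchySchwarz_sqrt (@dotmx C m) y x.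
exact: (real_leM yx (vnormE _) (vnormE _) le_yx).
Qed.

End OperatorNorm.

Section OperatorNormAlgebra.
Variables (R : realType) (n : nat).
Local Notation C := R[i].
Local Notation M := 'M[C]_n.+1.
Implicit Types (A B : M) (x : 'rV[C]_n.+1).

(* Matrices act on row vectors on the right. *)
Definition opnorm A : R := sup [set vnorm (x *m A) | x in [set x | vnorm x <= 1]].

(** A crude bound of the operator norm: it makes the supremum finite and deduces norm convergence
    from convergence of the entries. *)
Definition entry_sum A : R := \sum_i \sum_j absC (A i j).

Lemma vnorm_mul_entry_sum x A : vnorm (x *m A) <= vnorm x * entry_sum A.
Proof.
rewrite (le_trans (vnorm_le_sum _)) // /entry_sum exchange_big mulr_sumr.
apply: ler_sum => j _; rewrite mxE (le_trans (absC_sum _ _ _)) // mulr_sumr.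
by apply: ler_sum => i _; rewrite absCM ler_wpM2r ?absC_ge0 ?vnorm_coord.
Qed.

Lemma entry_sum_ge0 A : 0 <= entry_sum A.
Proof. by rewrite sumr_ge0 // => i _; rewrite sumr_ge0 // => j _; exact: absC_ge0. Qed.

Lemma opnorm_has_sup A :
  has_sup [set vnorm (x *m A) | x in [set x | vnorm x <= 1]].
Proof.
split; first by exists 0, 0; rewrite /= ?mul0mx vnorm0.
exists (entry_sum A) => _ [x /= x1 <-].
rewrite (le_trans (vnorm_mul_entry_sum _ _)) //.
by rewrite ler_piMl ?entry_sum_ge0.
Qed.

Lemma opnorm_ub A x : vnorm x <= 1 -> vnorm (x *m A) <= opnorm A.
Proof. by move=> x1; apply: (ub_le_sup (opnorm_has_sup A).2); exists x. Qed.

Lemma opnorm_le A (k : R) :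
  (forall x, vnorm x <= 1 -> vnorm (x *m A) <= k) -> opnorm A <= k.
Proof.
move=> Ak; apply: ge_sup; first exact: (opnorm_has_sup A).1.
by move=> _ [x /= x1 <-]; exact: Ak.
Qed.

Lemma opnorm_ge0 A : 0 <= opnorm A.
Proof. by rewrite (le_trans _ (opnorm_ub A (x := 0) _)) ?vnorm_ge0 ?vnorm0. Qed.

Lemma absC_real (r : R) : 0 <= r -> absC r%:C%C = r.
Proof. by move=> r0; apply: complexI; rewrite absCE ger0_norm // ler0c. Qed.

Lemma vnorm_mul A x : vnorm (x *m A) <= vnorm x * opnorm A.
Proof.
have [x0|x_neq0] := eqVneq (vnorm x) 0.
  by rewrite (vnorm_eq0 x0) mul0mx vnorm0 mul0r.
have x_gt0 : 0 < vnorm x by rewrite lt_def x_neq0 vnorm_ge0.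
have xV_ge0 : 0 <= (vnorm x)^-1 by rewrite invr_ge0 vnorm_ge0.
have := opnorm_ub A (x := (vnorm x)^-1%:C%C *: x).
rewrite -scalemxAl !vnormZ absC_real // mulVf // lexx => /(_ isT).
by rewrite ler_pdivrMl.
Qed.

Lemma opnorm_entry A i j : absC (A i j) <= opnorm A.
Proof.
have := opnorm_ub A (x := delta_mx 0 i); rewrite vnorm_delta lexx => /(_ isT).
apply: le_trans; rewrite -rowE; have := vnorm_coord (row i A) j.
by rewrite mxE.
Qed.

Lemma opnorm_le_entry_sum A : opnorm A <= entry_sum A.
Proof.
apply: opnorm_le => x x1; rewrite (le_trans (vnorm_mul_entry_sum _ _)) //.
by rewrite ler_piMl ?entry_sum_ge0.
Qed.

Lemma opnorm_eq0 A : opnorm A = 0 -> A = 0.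
Proof.
move=> A0; apply/matrixP => i j; rewrite mxE; apply: absC_eq0; apply/eqP.
by rewrite eq_le absC_ge0 andbT -A0 opnorm_entry.
Qed.

Lemma opnormD A B : opnorm (A + B) <= opnorm A + opnorm B.
Proof.
apply: opnorm_le => x x1; rewrite mulmxDr (le_trans (vnormD _ _)) //.
by rewrite lerD ?opnorm_ub.
Qed.

Lemma opnormZ_le c A : opnorm (c *: A) <= absC c * opnorm A.
Proof.
apply: opnorm_le => x x1; rewrite -scalemxAr vnormZ.
by rewrite ler_wpM2l ?absC_ge0 ?opnorm_ub.
Qed.

Lemma opnormZ c A : opnorm (c *: A) = complex.Re `|c| * opnorm A.
Proof.
rewrite -/(absC c); have [->|c0] := eqVneq c 0.
  by rewrite absC0 mul0r; apply/eqP; rewrite eq_le opnorm_ge0 andbT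
    (le_trans (opnormZ_le _ _)) // absC0 mul0r.
apply/eqP; rewrite eq_le opnormZ_le /=.
have abs_c : 0 < absC c.
  by rewrite lt_def absC_ge0 andbT; apply: contra c0 => /eqP/absC_eq0->.
(* The same inequality for the inverse scalar is the reverse inequality. *)
have := opnormZ_le c^-1 (c *: A); rewrite scalerA mulVf // scale1r.
have -> : absC c^-1 = (absC c)^-1.
  by apply: complexI; rewrite fmorphV /= !absCE normfV.
by rewrite ler_pdivlMl.
Qed.

Lemma opnormM A B : opnorm (A * B) <= opnorm A * opnorm B.
Proof.
apply: opnorm_le => x x1; rewrite -[A * B]/(A *m B) mulmxA.
rewrite (le_trans (vnorm_mul _ _)) // ler_wpM2r ?opnorm_ge0 //.
exact: opnorm_ub.
Qed.

Lemma opnorm_sqr_le A : opnorm A ^+ 2 <= opnorm (A * adjmx A).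
Proof.
have -> : opnorm (A * adjmx A) = Num.sqrt (opnorm (A * adjmx A)) ^+ 2.
  by rewrite sqr_sqrtr ?opnorm_ge0.
rewrite ler_pXn2r ?nnegrE ?opnorm_ge0 ?sqrtr_ge0 //.
apply: opnorm_le => x x1; rewrite -(ger0_norm (vnorm_ge0 _)) -sqrtr_sqr ler_wsqrtr //.
rewrite (le_trans (vnorm_mul_sqr _ _)) // -mulmxA.
rewrite (le_trans _ (opnorm_ub (A * adjmx A) x1)) //.
by rewrite ler_piMr ?vnorm_ge0.
Qed.

(** The squared norm of B^* is at most the norm of B^* B, hence at most the product of both norms;
    cancel one factor, then exchange B and B^*. *)
Lemma opnorm_adj A : opnorm (adjmx A) = opnorm A.
Proof.
have le_adj B : opnorm (adjmx B) <= opnorm B.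
  have := le_trans (opnorm_sqr_le (adjmx B)) (opnormM _ _).
  rewrite adjmxK expr2; have [->|B0] := eqVneq (opnorm (adjmx B)) 0.
    by rewrite opnorm_ge0.
  by rewrite ler_pM2l // lt_def B0 opnorm_ge0.
have := le_adj (adjmx A); rewrite adjmxK => le_A.
by apply: le_anti; apply/andP; split; [exact: le_adj | exact: le_A].
Qed.

Lemma opnorm_cstar A : opnorm (adjmx A * A) = opnorm A ^+ 2.
Proof.
apply/eqP; rewrite eq_le (le_trans (opnormM _ _)) ?opnorm_adj ?expr2 //=.
by have := opnorm_sqr_le (adjmx A); rewrite adjmxK opnorm_adj.
Qed.

Lemma opnorm_complete (u : nat -> M) :
  (forall e : R, 0 < e -> exists m, forall p q,
     (m <= p)%N -> (m <= q)%N -> opnorm (u p - u q) < e) ->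
  exists l : M, forall e : R, 0 < e -> exists m, forall p,
    (m <= p)%N -> opnorm (u p - l) < e.
Proof.
move=> u_cauchy.
have entry_cvg (ij : 'I_n.+1 * 'I_n.+1) : exists l : C,
    forall e : R, 0 < e -> exists m, forall p, (m <= p)%N -> absC (u p ij.1 ij.2 - l) < e.
  apply: complex_cauchy_cvg => e /u_cauchy[m um]; exists m => p q mp mq.
  apply: le_lt_trans (um p q mp mq).
  by have := opnorm_entry (u p - u q) ij.1 ij.2; rewrite !mxE.
have [l ul] := choice entry_cvg.
exists (\matrix_(i, j) l (i, j)) => e e0.
(* One share for each entry, and one more to make the final inequality strict. *)
pose d := e / (n.+1 * n.+1).+1%:R; have d0 : 0 < d by rewrite divr_gt0.
have [m um] := choice (fun ij => ul ij d d0).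
exists (\max_ij m ij) => p mp; apply: le_lt_trans (opnorm_le_entry_sum _) _.
apply: (@le_lt_trans _ _ (\sum_(i < n.+1) \sum_(j < n.+1) d)).
  apply: ler_sum => i _; apply: ler_sum => j _; rewrite !mxE ltW //.
  exact: (um (i, j) p (leq_trans (leq_bigmax (i, j)) mp)).
rewrite !sumr_const !card_ord -mulrnA -[d *+ _]mulr_natr /d mulrAC ltr_pdivrMr //.
by rewrite ltr_pM2l // ltr_nat.
Qed.

End OperatorNormAlgebra.

(** The target to which the universal property of C(G) is applied to obtain the model as a
    morphism. *)
Definition cstar_matrix (R : realType) (n : nat) := 'M[R[i]]_n.+1.

HB.instance Definition _ (R : realType) (n : nat) :=
  GRing.Algebra.copy (cstar_matrix R n) 'M[R[i]]_n.+1.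

HB.instance Definition _ (R : realType) (n : nat) :=
  isCStarAlgebra.Build R (cstar_matrix R n) (@adjmxK R n.+1) (@adjmxD R n.+1)
    (@adjmxZ R n.+1) (@adjmx_mulr R n) (@opnorm_ge0 R n) (@opnorm_eq0 R n)
    (@opnormD R n) (@opnormZ R n) (@opnormM R n) (@opnorm_cstar R n)
    (@opnorm_complete R n).

Section Model.
Variables (R : realType) (n : nat) (H : 'M[R[i]]_n.+1).
Variables (G : hadamard_qgroup H) (p : nat).
Local Notation C := R[i].
Local Notation P := (@hadamard_proj R n.+1 H : 'I_n.+1 -> 'I_n.+1 -> 'M[C]_n.+1).
Local Notation u := (@qg_coord R n.+1 H G).

Lemma model_fix_defect (xi : {ffun 'I_p -> 'I_n.+1} -> C) i :
  fix_defect u xi i = 0 -> fix_defect P xi i = 0.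
Proof.
have Padj k l : adj (P k l : cstar_matrix R n) = P k l by exact: hadamard_proj_adj.
have Pker a : qg_ideal G a -> free_eval (P : _ -> _ -> cstar_matrix R n) a = 0.
  by case: (qg_ideal_largest G) => _ Jker _ /Jker.
have [rho [_ rho_u _]] := qg_univ Padj Pker.
move=> /(congr1 rho); rewrite (fix_defect_morph _ _ _ (raddfD rho) (linearZZ rho)
  (rmorphM rho) (rmorph1 rho)) rmorph0 => <-.
by apply: eq_fix_defect => k l; exact/esym/rho_u.
Qed.
End Model.

(** * Bicharacters and the model of a deformed Fourier matrix *)

Section Bicharacter.
Variables (C : numFieldType) (V : finZmodType).

(** A nondegenerate symmetric pairing of V with itself; [bichar_sum] is the orthogonality of
    characters. Working with abstract X and Y makes the passage to the transpose an exchange of the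
    two. *)
Record bicharacter (k : V -> V -> C) : Prop := {
  bicharD : forall x y z, k (x + y) z = k x z * k y z;
  bicharC : forall x y, k x y = k y x;
  bichar_neq0 : forall x y, k x y != 0;
  bichar_sum : forall x, \sum_y k x y = #|V|%:R * (x == 0)%:R
}.

Variables (k : V -> V -> C) (k_bichar : bicharacter k).

Lemma bichar0 x : k 0 x = 1.
Proof.
apply: (mulfI (bichar_neq0 k_bichar 0 x)).
by rewrite -(bicharD k_bichar) addr0 mulr1.
Qed.

Lemma bicharDr x y z : k z (x + y) = k z x * k z y.
Proof. by rewrite !(bicharC k_bichar z) (bicharD k_bichar). Qed.

Lemma bicharN x y : k (- x) y = (k x y)^-1.
Proof.
apply: (mulfI (bichar_neq0 k_bichar x y)).
by rewrite mulfV ?(bichar_neq0 k_bichar) // -(bicharD k_bichar) subrr bichar0.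
Qed.

Lemma bicharB x y z : k (x - y) z = k x z / k y z.
Proof. by rewrite (bicharD k_bichar) bicharN. Qed.

Lemma bicharNr x y : k y (- x) = (k y x)^-1.
Proof. by rewrite !(bicharC k_bichar y) bicharN. Qed.

Lemma bichar_multi_sum (I : finType) (a : I -> V) :
  \sum_(b : {ffun I -> V}) \prod_s k (a s) (b s)
    = (#|V| ^ #|I|)%:R * [forall s, a s == 0]%:R.
Proof.
rewrite -(bigA_distr_bigA (fun s z => k (a s) z)).
under eq_bigr do rewrite (bichar_sum k_bichar).
rewrite big_split /= prodr_const natrX; congr (_ * _).
case: forallP => [a0 | a_neq0].
  by rewrite big1 // => s _; rewrite a0.
have [s as0] : exists s, a s != 0.
  by apply/existsP; rewrite -negb_forall; apply/negP => /forallP.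
by rewrite (bigD1 s) //= (negPf as0) mul0r.
Qed.

Lemma card_zmod_neq0 : #|V|%:R != 0 :> C.
Proof. by rewrite pnatr_eq0 -lt0n; apply/card_gt0P; exists 0. Qed.

End Bicharacter.

Section CyclicDifferences.
Variable p : nat.
Local Notation I := 'I_p.+1.

Definition cyc_diff (V : zmodType) (b : I -> V) (s : I) : V := b s - b (ord_pred s).

Lemma cyc_reindex (T : Type) (idx : T) (op : Monoid.com_law idx) (f : I -> T) :
  \big[op/idx]_s f (ord_pred s) = \big[op/idx]_s f s.
Proof. by rewrite [RHS](reindex_inj (@ord_pred_inj p.+1)). Qed.

Lemma cyc_const (T : Type) (a : I -> T) :
  (forall s, a (ord_pred s) = a s) -> forall s, a s = a ord0.
Proof.
move=> a_pred; case=> m; elim: m => [|m IH] lt_mp; first by congr a; apply: val_inj.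
rewrite -(IH (ltnW lt_mp)) -a_pred; congr a; apply: val_inj => /=.
by rewrite modnDr modn_small // ltnW.
Qed.

Lemma chain_mulmx (C : comNzRingType) n (m : nat) (M : 'I_m -> 'M[C]_n.+1)
    (v : nat -> 'cV[C]_n.+1) (l : 'I_m -> C) :
  (forall s : 'I_m, M s *m v s.+1 = l s *: v s) ->
  (\prod_s M s) *m v m = (\prod_s l s) *: v 0%N.
Proof.
elim: m M l => [|m IH] M l Mv; first by rewrite !big_ord0 mul1mx scale1r.
rewrite !big_ord_recr /= -[_ * _]/(_ *m _) -mulmxA (Mv ord_max) -scalemxAr.
by rewrite (IH _ (fun s => l (widen_ord (leqnSn m) s))) ?scalerA 1?mulrC // => s;
  exact: (Mv (widen_ord _ s)).
Qed.

(** The factors, applied from the last to the first, carry the vector once around the cycle: the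
    predecessor of the first index is the last one. *)
Lemma cyclic_mulmx (C : comNzRingType) n (V : Type) (M : I -> 'M[C]_n.+1)
    (v : V -> 'cV[C]_n.+1) (b : I -> V) (l : I -> C) :
  (forall s, M s *m v (b s) = l s *: v (b (ord_pred s))) ->
  (\prod_s M s) *m v (b ord_max) = (\prod_s l s) *: v (b ord_max).
Proof.
(* [c] unrolls [b] into a sequence shifted by one, with [c s.+1 = b s], so that its first and last
   terms are both [b ord_max]. *)
move=> Mv; pose c t := b (inord ((t + p) %% p.+1)).
have c0 : c 0%N = b ord_max.
  by congr b; apply: val_inj; rewrite /= modn_small // inordK.
have cS (s : I) : c s.+1 = b s.
  by congr b; apply: val_inj; rewrite /= addSnnS modnDr modn_small ?inordK.
have cP (s : I) : c s = b (ord_pred s).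
  by congr b; apply: val_inj; rewrite /= inordK ?ltn_pmod // addnS.
have := @chain_mulmx C n p.+1 M (fun t => v (c t)) l _.
rewrite c0 (cS ord_max); apply=> s.
by rewrite cS cP.
Qed.

End CyclicDifferences.

Section Translations.
Variables (p : nat) (V : finZmodType).
Local Notation I := 'I_p.+1.
Implicit Types b c : {ffun I -> V}.

Definition translate b (y : V) : {ffun I -> V} := [ffun s => b s + y].

Lemma cyc_diff_translate b y s : cyc_diff (translate b y) s = cyc_diff b s.
Proof. by rewrite /cyc_diff !ffunE opprD addrACA subrr addr0. Qed.

(** The indicator, as a character sum leaves it, says that c - b is constant, i.e., that c is a
    translate of b. *)
Lemma translate_sum (C : nzRingType) b (f : {ffun I -> V} -> C) :
  \sum_(c : {ffun I -> V}) [forall s, c (ord_pred s) - b (ord_pred s) == c s - b s]%:R * f c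
    = \sum_y f (translate b y).
Proof.
rewrite (bigID (fun c : {ffun I -> V} =>
  [forall s, c (ord_pred s) - b (ord_pred s) == c s - b s])) /=.
rewrite [X in _ + X]big1 ?addr0 => [|c /negPf->]; last by rewrite mul0r.
rewrite (reindex_onto (translate b) (fun c => c ord0 - b ord0)) /= => [|c /forallP cb].
  apply: eq_big => y; last by case/andP => -> _; rewrite mul1r.
  rewrite ffunE addrC addKr eqxx andbT; apply/forallP => s.
  by rewrite !ffunE !(addrC (b _)) !addrK.
apply/ffunP => s; rewrite ffunE.
have <- := @cyc_const p V (fun s => c s - b s) (fun s => eqP (cb s)) s.
by rewrite addrC subrK.
Qed.

End Translations.

Section CharacterModel.
Variables (C : numFieldType) (X Y : finZmodType).
Variables (kX : X -> X -> C) (kY : Y -> Y -> C).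
Hypotheses (kX_bichar : bicharacter kX) (kY_bichar : bicharacter kY).
Variables (q : X -> Y -> C) (q_neq0 : forall x y, q x y != 0).
Variables (n : nat) (e : 'I_n.+1 -> X * Y) (e' : X * Y -> 'I_n.+1).
Hypotheses (eK : cancel e e') (e'K : cancel e' e).

(** The entry in column z of the quotient of the rows r and s of the matrix with entries q(r_1, z_2)
    kX(r_1, z_1) kY(r_2, z_2). *)
Definition ratio_row (r s z : X * Y) : C :=
  q r.1 z.2 / q s.1 z.2 * kX (r.1 - s.1) z.1 * kY (r.2 - s.2) z.2.

Variable P : X * Y -> X * Y -> 'M[C]_n.+1.
Hypothesis PE : forall r s k l,
  P r s k l = ratio_row r s (e k) / ratio_row r s (e l) / n.+1%:R.

Let cardXY : n.+1 = (#|X| * #|Y|)%N.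
Proof. by rewrite -card_prod -(card_ord n.+1); exact: (bij_eq_card (Bijective eK e'K)). Qed.

Let big_e (F : X * Y -> C) : \sum_k F (e k) = \sum_x \sum_y F (x, y).
Proof.
rewrite pair_bigA [LHS](reindex e'); last by exists e => z _.
by apply: eq_bigr => -[x y] _; rewrite e'K.
Qed.

(** A character in the variable of X times a point mass in the variable of Y. *)
Definition test_vec (d : X) (z : Y) : 'cV[C]_n.+1 :=
  \col_k (kX d (e k).1 * ((e k).2 == z)%:R).

Lemma test_vec_ind (c : C) (M : 'M[C]_n.+1) :
  (forall d z, M *m test_vec d z = c *: test_vec d z) -> M = c *: 1.
Proof.
move=> Mf; apply/matrixP => k l.
(* Fourier inversion in X: the test vectors span all columns, so that a matrix acting on each of
   them by the same scalar is scalar. *)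
have delta_l : \sum_d (kX d (e l).1)^-1 *: test_vec d (e l).2
    = #|X|%:R *: (delta_mx l 0 : 'cV_n.+1).
  apply/colP => i; rewrite summxE !mxE eqxx andbT.
  under eq_bigr => d _ do rewrite !mxE mulrA -(bicharNr kX_bichar)
    (bicharC kX_bichar _ (- _)) (bicharC kX_bichar d) -(bicharD kX_bichar) addrC.
  rewrite -mulr_suml (bichar_sum kX_bichar) -mulrA; congr (_ * _).
  rewrite -natrM mulnb; congr (nat_of_bool _)%:R.
  by rewrite subr_eq0 -(inj_eq (can_inj eK)) [e i]surjective_pairing
    [e l]surjective_pairing xpair_eqE.
have : M *m (#|X|%:R *: (delta_mx l 0 : 'cV_n.+1)) = c *: (#|X|%:R *: delta_mx l 0).
  rewrite -delta_l mulmx_sumr scaler_sumr; apply: eq_bigr => d _.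
  by rewrite -scalemxAr Mf scalerA mulrC -scalerA.
rewrite -scalemxAr scalerA mulrC -scalerA => /(scalerI (card_zmod_neq0 _ _)).
rewrite -colE => /colP/(_ k); rewrite !mxE eqxx andbT => ->.
by rewrite -mulr_natr.
Qed.

(** In the pairing of the test vector with the row quotient, the point mass fixes the coordinate z
    in Y, and orthogonality of the characters of X selects d = r_1 - s_1. *)
Lemma model_test_vec r s d z : P r s *m test_vec d z =
  ((r.1 - s.1 == d)%:R / #|Y|%:R) *: \sum_w (q r.1 w / q s.1 w / (q r.1 z / q s.1 z)
     * kY (r.2 - s.2) (w - z)) *: test_vec d w.
Proof.
apply/colP => k; rewrite !mxE summxE.
set D := r.1 - s.1; set A := r.2 - s.2.
pose g w := q r.1 w / q s.1 w; have g_neq0 w : g w != 0.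
  by rewrite mulf_neq0 ?invr_neq0.
have kX0 x y := bichar_neq0 kX_bichar x y; have kY0 x y := bichar_neq0 kY_bichar x y.
pose F (t : X * Y) := ratio_row r s (e k) / ratio_row r s t / n.+1%:R
    * (kX d t.1 * (t.2 == z)%:R).
transitivity (\sum_l F (e l)); first by apply: eq_bigr => l _; rewrite !mxE PE.
rewrite big_e /F exchange_big (bigD1 z) //= [X in _ + X]big1 ?addr0; last first.
  by move=> w /negPf wz; rewrite big1 // => x _; rewrite wz !mulr0.
rewrite [in RHS](bigD1 (e k).2) //= [X in _ + X]big1 ?addr0; last first.
  by move=> w /negPf wz; rewrite !mxE eq_sym wz !mulr0.
rewrite !mxE !eqxx !mulr1 /ratio_row /= -/D -/A -/(g _) -/(g z).
transitivity (\sum_x (g (e k).2 * kX D (e k).1 * kY A (e k).2 / (g z * kY A z) / n.+1%:R)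
    * kX (d - D) x).
  apply: eq_bigr => x _; rewrite (bicharB kX_bichar d D) mulr1; set N := n.+1%:R.
  by rewrite !invfM; ring.
rewrite -mulr_sumr (bichar_sum kX_bichar) subr_eq0 [d == D]eq_sym.
have [->|] := eqVneq D d; last by rewrite mulr0 mulr0 !mul0r.
rewrite cardXY natrM (bicharC kY_bichar _ (_ - z)) (bicharB kY_bichar).
rewrite !(bicharC kY_bichar _ A) !mulr1 mul1r.
have X0 : #|X|%:R != 0 :> C := card_zmod_neq0 C X.
have Y0 : #|Y|%:R != 0 :> C := card_zmod_neq0 C Y.
by field; rewrite X0 Y0 kY0 g_neq0.
Qed.

(* On test vectors the projections act diagonally in the variable of X and by
   convolution in the variable of Y; a Fourier transform in the row label turns
   them into weighted shifts. *)
Definition model_fourier (x y : X) (c : Y) : 'M[C]_n.+1 :=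
  \sum_t kY t c *: P (x, t) (y, 0).

Lemma model_translate x y a b : P (x, a) (y, b) = P (x, a - b) (y, 0).
Proof. by apply/matrixP => k l; rewrite !PE /ratio_row /= subr0. Qed.

Lemma model_fourierl x y b c :
  \sum_a kY (a - b) c *: P (x, a) (y, b) = model_fourier x y c.
Proof.
rewrite /model_fourier [RHS](reindex_inj (addIr (- b))) /=.
by apply: eq_bigr => a _; rewrite -model_translate.
Qed.

Lemma model_fourierr x y a c :
  \sum_b kY (a - b) c *: P (x, a) (y, b) = model_fourier x y c.
Proof.
rewrite /model_fourier [RHS](reindex_inj (can_inj (subKr a))) /=.
by apply: eq_bigr => b _; rewrite -model_translate.
Qed.

Lemma model_fourier_test x y c d z : model_fourier x y c *m test_vec d z =
  ((x - y == d)%:R * (q x (z - c) / q y (z - c) / (q x z / q y z))) *: test_vec d (z - c).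
Proof.
rewrite /model_fourier mulmx_suml.
under eq_bigr => t _ do rewrite -scalemxAl model_test_vec /= subr0 scalerA scaler_sumr.
(* The sum over the label t is a character sum over Y, which vanishes unless w = z - c. *)
rewrite exchange_big (bigD1 (z - c)) //= [X in _ + X]big1 ?addr0 => [|w wzc].
  under eq_bigr => t _ do rewrite scalerA.
  rewrite -scaler_suml; congr (_ *: _).
  transitivity (\sum_(t : Y) ((x - y == d)%:R * (q x (z - c) / q y (z - c) / (q x z / q y z)))
      / #|Y|%:R).
    apply: eq_bigr => t _; rewrite [z - c - z]addrAC subrr add0r (bicharNr kY_bichar).
    have := bichar_neq0 kY_bichar t c; set k := kY t c => k0.
    have Y0 : #|Y|%:R != 0 :> C := card_zmod_neq0 C Y.
    by field; rewrite k0 Y0 !q_neq0.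
  by rewrite sumr_const -[_ *+ _]mulr_natr divfK // card_zmod_neq0.
under eq_bigr => t _ do rewrite scalerA.
rewrite -scaler_suml; set S := (X in X *: _).
suff -> : S = 0 by rewrite scale0r.
transitivity (\sum_t ((x - y == d)%:R / #|Y|%:R * (q x w / q y w / (q x z / q y z)))
    * kY (w - z + c) t).
  apply: eq_bigr => t _; rewrite (bicharD kY_bichar) !(bicharC kY_bichar t).
  by rewrite !mulrA; ring.
rewrite -mulr_sumr (bichar_sum kY_bichar) [_ == 0](_ : _ = false) ?mulr0 //.
apply/negP => /eqP wz; case/eqP: wzc.
by rewrite -[w](subrK z) -[w - z](addrK c) wz sub0r addrC.
Qed.

Section Products.
Variable p : nat.
Local Notation I := 'I_p.+1.
Local Notation FX := {ffun I -> X}.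
Local Notation FY := {ffun I -> Y}.

Definition model_word (i : FX) (a : FY) (j : FX) (b : FY) : 'M[C]_n.+1 :=
  \prod_s P (i s, a s) (j s, b s).

Definition model_fixed (xi : FX -> FY -> C) : Prop :=
  forall i a, \sum_j \sum_b xi j b *: model_word i a j b = xi i a *: 1.

Definition phase (i : FX) (b : FY) : C :=
  \prod_s (q (i s) (b (ord_pred s)) / q (i s) (b s)).

Lemma phase_neq0 i b : phase i b != 0.
Proof. by apply/prodf_neq0 => s _; rewrite mulf_neq0 ?invr_neq0. Qed.

Definition model_fourier_word (i j : FX) (b : FY) : 'M[C]_n.+1 :=
  \prod_s model_fourier (i s) (j s) (cyc_diff b s).

(** As the projections see only a - b, transforming in the row labels or in the column labels gives
    the same matrix. The former turns the equation of a fixed vector into one for its transform, the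
    latter does the converse. *)
Lemma model_wordl (i j : FX) (b c : FY) :
  \sum_(a : FY) (\prod_s kY (a s - b s) (cyc_diff c s)) *: model_word i a j b
  = model_fourier_word i j c.
Proof.
rewrite /model_fourier_word /model_word.
under [RHS]eq_bigr => s _ do rewrite -(model_fourierl _ _ (b s)).
by rewrite bigA_distr_bigA; apply: eq_bigr => a _; rewrite scaler_prod.
Qed.

Lemma model_wordr (i : FX) (a : FY) (j : FX) (c : FY) :
  \sum_(b : FY) (\prod_s kY (a s - b s) (cyc_diff c s)) *: model_word i a j b
  = model_fourier_word i j c.
Proof.
rewrite /model_fourier_word /model_word.
under [RHS]eq_bigr => s _ do rewrite -(model_fourierr _ _ (a s)).
by rewrite bigA_distr_bigA; apply: eq_bigr => b _; rewrite scaler_prod.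
Qed.

(** The frequencies are cyclic differences of b, so the weighted shifts lead from [b ord_max] back
    to itself; their weights multiply to the quotient of phases. *)
Lemma model_fourier_word_test i j b d :
  model_fourier_word i j b *m test_vec d (b ord_max)
    = ((j == translate i (- d))%:R * (phase i b / phase j b)) *: test_vec d (b ord_max).
Proof.
rewrite (cyclic_mulmx (l := fun s => (i s - j s == d)%:R *
  (q (i s) (b (ord_pred s)) / q (j s) (b (ord_pred s)) / (q (i s) (b s) / q (j s) (b s))))).
  congr (_ *: _); rewrite big_split /=; congr (_ * _); last first.
    rewrite -prodf_div; apply: eq_bigr => s _; rewrite !invfM !invrK.
    by field; rewrite !q_neq0.
  have [->|ji] := eqVneq j (translate i (- d)).
    by rewrite big1 // => s _; rewrite ffunE opprD opprK addNKr eqxx.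
  have [s js] : exists s, i s - j s != d.
    apply/existsP; rewrite -negb_forall; apply: contra ji => /forallP ij.
    by apply/eqP/ffunP => s; rewrite ffunE -(eqP (ij s)) opprB addrC subrK.
  by rewrite (bigD1 s) //= (negPf js) mul0r.
by move=> s; rewrite model_fourier_test /cyc_diff subKr.
Qed.

(* A Fourier transform in the row labels a_s gives functions of frequencies c_s
   with zero sum, which are parametrized as cyclic differences of b. *)
Definition row_transform (xi : FX -> FY -> C) (i : FX) (b : FY) : C :=
  \sum_a xi i a * \prod_s kY (a s) (cyc_diff b s).

(** The exponent is p + 2 because inversion produces p + 1 character sums over Y and then a sum over
    the #|Y| translates that they leave. *)
Definition row_inverse (eta : FX -> FY -> C) (i : FX) (a : FY) : C :=
  (#|Y| ^ p.+2)%:R^-1 * \sum_b eta i b / \prod_s kY (a s) (cyc_diff b s).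

(* Translating the row labels by t conjugates the projections by the diagonal
   unitary kY t, and scalar matrices are invariant under this conjugation. *)
Lemma model_fixed_invariant xi i a t :
  model_fixed xi -> xi i (translate a t) = xi i a.
Proof.
move=> xi_fixed.
pose tw (k l : 'I_n.+1) := kY t (e k).2 / kY t (e l).2.
have tw_kk k : tw k k = 1 by rewrite /tw mulfV ?(bichar_neq0 kY_bichar).
have P_tw (r s : X * Y) k l : P (r.1, r.2 + t) s k l = tw k l * P r s k l.
  rewrite !PE /ratio_row /= /tw addrAC !(bicharD kY_bichar _ t) !invfM.
  by ring.
have word_tw j b (m : nat) (f : 'I_m -> I) k l :
    (\prod_(s < m) P (i (f s), translate a t (f s)) (j (f s), b (f s))) k l
    = tw k l * (\prod_(s < m) P (i (f s), a (f s)) (j (f s), b (f s))) k l.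
  elim: m f k l => [|m IH] f k l.
    rewrite !big_ord0 !mxE; have [->|] := eqVneq k l; last by rewrite mulr0.
    by rewrite tw_kk mulr1.
  rewrite !big_ord_recr /= !mxE mulr_sumr; apply: eq_bigr => r _.
  rewrite (IH (fun s => f (widen_ord (leqnSn m) s))) ffunE.
  rewrite (P_tw (i _, a _)) mulrACA; congr (_ * _).
  rewrite /tw; have := bichar_neq0 kY_bichar t (e r).2; set u := kY t (e r).2 => u0.
  by field; rewrite u0 (bichar_neq0 kY_bichar).
have /matrixP/(_ ord0 ord0) := xi_fixed i (translate a t).
have /matrixP/(_ ord0 ord0) := xi_fixed i a.
rewrite !mxE eqxx !mulr1 => <- <-.
rewrite !summxE; apply: eq_bigr => j _; rewrite !summxE; apply: eq_bigr => b _.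
by rewrite !mxE (word_tw j b _ id) tw_kk mul1r.
Qed.

Lemma row_transform_translate xi i b y : row_transform xi i (translate b y) = row_transform xi i b.
Proof.
by apply: eq_bigr => a _; congr (_ * _); apply: eq_bigr => s _; rewrite cyc_diff_translate.
Qed.

Lemma test_vec_neq0 d z : test_vec d z != 0.
Proof.
apply/eqP => /colP/(_ (e' (0, z))); rewrite !mxE e'K eqxx mulr1 => /eqP.
by rewrite (negPf (bichar_neq0 kX_bichar _ _)).
Qed.

Lemma row_transform_fixed xi i b d : model_fixed xi ->
  row_transform xi (translate i d) b / phase (translate i d) b = row_transform xi i b / phase i b.
Proof.
move=> xi_fixed.
have sum_fixed : \sum_j row_transform xi j b *: model_fourier_word i j b
    = row_transform xi i b *: 1.
  rewrite /row_transform scaler_suml.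
  under [RHS]eq_bigr => a _ do rewrite mulrC -scalerA -xi_fixed scaler_sumr.
  rewrite exchange_big /=; apply: eq_bigr => j _.
  rewrite scaler_suml.
  under [RHS]eq_bigr => a _ do rewrite scaler_sumr.
  rewrite exchange_big /=; apply: eq_bigr => a' _.
  rewrite -(model_wordl i j a' b) scaler_sumr; apply: eq_bigr => a _.
  rewrite !scalerA; congr (_ *: _); rewrite -mulrA [RHS]mulrC; congr (_ * _).
  rewrite -big_split /=; apply: eq_bigr => s _.
  by rewrite -(bicharD kY_bichar) addrC subrK.
(* Testing at the character -d isolates the term j = i + d of the sum. *)
have := congr1 (mulmx^~ (test_vec (- d) (b ord_max))) sum_fixed.
rewrite /= mulmx_suml.
under eq_bigr => j _ do rewrite -scalemxAl model_fourier_word_test scalerA opprK.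
rewrite (bigD1 (translate i d)) //= [X in _ + X]big1 ?addr0; last first.
  by move=> j /negPf->; rewrite mul0r mulr0 scale0r.
rewrite eqxx mul1r -scalemxAl mul1mx => /eqP; rewrite -subr_eq0 -scalerBl scaler_eq0.
rewrite (negPf (test_vec_neq0 _ _)) orbF subr_eq0 => /eqP <-.
by field; rewrite !phase_neq0.
Qed.

Lemma row_inverse_fixed eta :
  (forall i b y, eta i (translate b y) = eta i b) ->
  (forall i b d, eta (translate i d) b / phase (translate i d) b = eta i b / phase i b) ->
  model_fixed (row_inverse eta).
Proof.
move=> etaY etaX i a; apply: test_vec_ind => d z.
set K := (#|Y| ^ p.+2)%:R^-1 : C.
have -> : \sum_j \sum_b row_inverse eta j b *: model_word i a j b
    = K *: \sum_(c : FY) (\prod_s kY (a s) (cyc_diff c s))^-1 *: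
        \sum_j eta j c *: model_fourier_word i j c.
  rewrite scaler_sumr; under [RHS]eq_bigr do rewrite !scaler_sumr.
  rewrite [RHS]exchange_big /=; apply: eq_bigr => j _.
  rewrite /row_inverse; under eq_bigr do rewrite mulr_sumr scaler_suml.
  rewrite exchange_big /=; apply: eq_bigr => c _.
  rewrite -(model_wordr i a j c) !scaler_sumr; apply: eq_bigr => b _.
  rewrite !scalerA; congr (_ *: _); rewrite -/K -!mulrA; congr (_ * _).
  rewrite [RHS]mulrCA; congr (_ * _); rewrite -!prodfV -big_split /=.
  apply: eq_bigr => s _; rewrite (bicharB kY_bichar) mulKf //.
  exact: (bichar_neq0 kY_bichar).
rewrite -scalemxAl mulmx_suml /row_inverse -/K -scalerA; congr (_ *: _).
rewrite scaler_suml; apply: eq_bigr => c _.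
rewrite -scalemxAl mulrC -scalerA; congr (_ *: _).
(* The eigenvector equation requires the walk to end at z; translating c achieves this and changes
   neither [eta] nor the cyclic differences. *)
pose c' := translate c (z - c ord_max); have c'z : c' ord_max = z by rewrite ffunE addrC subrK.
have -> : \sum_j eta j c *: model_fourier_word i j c
    = \sum_j eta j c' *: model_fourier_word i j c'.
  apply: eq_bigr => j _; rewrite etaY; congr (_ *: _).
  by apply: eq_bigr => s _; rewrite cyc_diff_translate.
rewrite -{1}c'z mulmx_suml.
under eq_bigr => j _ do rewrite -scalemxAl model_fourier_word_test scalerA.
rewrite (bigD1 (translate i (- d))) //= [X in _ + X]big1 ?addr0; last first.
  by move=> j /negPf->; rewrite mul0r mulr0 scale0r.
rewrite eqxx mul1r c'z; congr (_ *: _).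
by rewrite mulrCA mulrA -[_ * _ / _]mulrA etaX mulrC divfK ?phase_neq0 // etaY.
Qed.

Lemma row_transformK xi i a : (forall t, xi i (translate a t) = xi i a) ->
  row_inverse (row_transform xi) i a = xi i a.
Proof.
move=> xi_inv; rewrite /row_inverse /row_transform.
under eq_bigr do rewrite mulr_suml.
rewrite exchange_big /=.
transitivity ((#|Y| ^ p.+2)%:R^-1 * \sum_(a' : FY) (#|Y| ^ p.+1)%:R *
    ([forall s, a' (ord_pred s) - a (ord_pred s) == a' s - a s]%:R * xi i a')).
  congr (_ * _); apply: eq_bigr => a' _.
  (* Cyclic summation by parts moves the difference operator from b to a' - a, so that the b_s
     become independent characters. *)
  transitivity (xi i a' * \sum_(b : FY) \prod_s
     kY ((a' s - a s) - (a' (ordS s) - a (ordS s))) (b s)).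
    rewrite mulr_sumr; apply: eq_bigr => b _; rewrite -mulrA; congr (_ * _).
    rewrite -prodf_div.
    under eq_bigr => s _ do rewrite -(bicharB kY_bichar) /cyc_diff
      (bicharDr kY_bichar) (bicharNr kY_bichar).
    under [RHS]eq_bigr => s _ do rewrite (bicharB kY_bichar (a' s - a s)).
    rewrite !prodf_div; congr (_ / _).
    rewrite -[RHS](cyc_reindex _ (fun s => kY (a' (ordS s) - a (ordS s)) (b s))).
    by apply: eq_bigr => s _; rewrite ord_predK.
  rewrite (bichar_multi_sum kY_bichar) card_ord mulrCA; congr (_ * _).
  rewrite mulrC; congr ((nat_of_bool _)%:R * _).
  apply/forallP/forallP => H s.
    by have := H (ord_pred s); rewrite ord_predK subr_eq0.
  by have := H (ordS s); rewrite ordSK subr_eq0.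
rewrite -mulr_sumr translate_sum; under eq_bigr do rewrite xi_inv.
rewrite sumr_const -[_ *+ _]mulr_natr expnS [in LHS]mulnC natrM.
have Y0 : #|Y|%:R != 0 :> C := card_zmod_neq0 C Y.
by rewrite natrX; field; rewrite Y0 ?expf_neq0.
Qed.

Lemma row_inverseK eta i b : (forall y, eta i (translate b y) = eta i b) ->
  row_transform (row_inverse eta) i b = eta i b.
Proof.
move=> eta_inv; rewrite /row_inverse /row_transform.
under eq_bigr do rewrite -mulrA mulr_suml.
rewrite -mulr_sumr exchange_big /=.
transitivity ((#|Y| ^ p.+2)%:R^-1 * \sum_(c : FY) (#|Y| ^ p.+1)%:R *
    ([forall s, c (ord_pred s) - b (ord_pred s) == c s - b s]%:R * eta i c)).
  congr (_ * _); apply: eq_bigr => c _.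
  transitivity (eta i c * \sum_(a : FY) \prod_s kY (cyc_diff b s - cyc_diff c s) (a s)).
    rewrite mulr_sumr; apply: eq_bigr => a _; rewrite -mulrA; congr (_ * _).
    rewrite mulrC -prodf_div; apply: eq_bigr => s _.
    by rewrite !(bicharC kY_bichar (a s)) -(bicharB kY_bichar).
  rewrite (bichar_multi_sum kY_bichar) card_ord mulrCA; congr (_ * _).
  rewrite mulrC; congr ((nat_of_bool _)%:R * _).
  apply: eq_forallb => s; rewrite /cyc_diff -[RHS]subr_eq0; congr (_ == 0).
  by rewrite !opprB addrACA [RHS]addrACA (addrC (b s)).
rewrite -mulr_sumr translate_sum; under eq_bigr do rewrite eta_inv.
rewrite sumr_const -[_ *+ _]mulr_natr expnS [in LHS]mulnC natrM.
have Y0 : #|Y|%:R != 0 :> C := card_zmod_neq0 C Y.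
by rewrite natrX; field; rewrite Y0 ?expf_neq0.
Qed.

End Products.

End CharacterModel.

(** * Duality of the fixed spaces and equality of the traces *)

Section TraceComparison.
Variables (C : comNzRingType) (S S' : finType).
Variables (T : S -> S -> C) (T' : S' -> S' -> C) (l : S' -> S -> C) (l' : S -> S' -> C).
Local Notation L f := (fun s => \sum_i l s i * f i).
Local Notation L' f := (fun i => \sum_s l' i s * f s).

(** tr T = tr(l' l T) = tr(l' T' l T), which by cyclicity of the trace is tr(l T l' T') = tr(l l'
    T') = tr T'. *)
Lemma trace_comparison :
  (forall j i, L' (L (T^~ j)) i = T i j) -> (forall t s, L (L' (T'^~ t)) s = T' s t) ->
  (forall j s, \sum_t T' s t * L (T^~ j) t = L (T^~ j) s) ->
  (forall t i, \sum_j T i j * L' (T'^~ t) j = L' (T'^~ t) i) ->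
  \sum_i T i i = \sum_s T' s s.
Proof.
move=> L'L LL' T'L TL'.
pose F i s t j := l' i s * T' s t * (l t j * T j i).
transitivity (\sum_i \sum_s \sum_t \sum_j F i s t j).
  apply: eq_bigr => i _; rewrite -[LHS]L'L; apply: eq_bigr => s _.
  rewrite -T'L mulr_sumr; apply: eq_bigr => t _.
  by rewrite mulrA mulr_sumr; apply: eq_bigr.
transitivity (\sum_t \sum_j \sum_i \sum_s F i s t j); last first.
  apply: eq_bigr => t _; rewrite -[RHS]LL'; apply: eq_bigr => j _.
  rewrite -TL' mulr_sumr; apply: eq_bigr => i _.
  rewrite mulrA mulr_sumr; apply: eq_bigr => s _.
  by rewrite /F mulrC.
under eq_bigr => i _ do rewrite exchange_big.
rewrite exchange_big; apply: eq_bigr => t _ /=.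
under eq_bigr => i _ do rewrite exchange_big.
by rewrite exchange_big.
Qed.
End TraceComparison.

Section Duality.
Variables (C : numFieldType) (X Y : finZmodType).
Variables (kX : X -> X -> C) (kY : Y -> Y -> C).
Hypotheses (kX_bichar : bicharacter kX) (kY_bichar : bicharacter kY).
Variables (q : X -> Y -> C) (q_neq0 : forall x y, q x y != 0).
Variables (n : nat) (e : 'I_n.+1 -> X * Y) (e' : X * Y -> 'I_n.+1).
Hypotheses (eK : cancel e e') (e'K : cancel e' e).
Variables (et : 'I_n.+1 -> Y * X) (et' : Y * X -> 'I_n.+1).
Hypotheses (etK : cancel et et') (et'K : cancel et' et).
Let qt y x := q x y.
Variables (P : X * Y -> X * Y -> 'M[C]_n.+1) (Pt : Y * X -> Y * X -> 'M[C]_n.+1).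
Hypothesis PE : forall r s k l, P r s k l
  = ratio_row kX kY q r s (e k) / ratio_row kX kY q r s (e l) / n.+1%:R.
Hypothesis PtE : forall r s k l, Pt r s k l
  = ratio_row kY kX qt r s (et k) / ratio_row kY kX qt r s (et l) / n.+1%:R.
Variable p : nat.
Local Notation I := 'I_p.+1.
Local Notation FX := {ffun I -> X}.
Local Notation FY := {ffun I -> Y}.

Definition cyc_next (b : FY) : FY := [ffun s => b (ordS s)].
Definition cyc_prev (b : FY) : FY := [ffun s => b (ord_pred s)].

Lemma cyc_prevK : cancel cyc_prev cyc_next.
Proof. by move=> b; apply/ffunP => s; rewrite !ffunE ordSK. Qed.

Lemma cyc_nextK : cancel cyc_next cyc_prev.
Proof. by move=> b; apply/ffunP => s; rewrite !ffunE ord_predK. Qed.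

Lemma translate_next b y : cyc_next (translate b y) = translate (cyc_next b) y.
Proof. by apply/ffunP => s; rewrite !ffunE. Qed.

Lemma translate_prev b y : cyc_prev (translate b y) = translate (cyc_prev b) y.
Proof. by apply/ffunP => s; rewrite !ffunE. Qed.

(** In the phase of the transpose the shifted index is i; reindexing the cycle moves the shift to b,
    where numerator and denominator are exchanged. *)
Lemma phase_next i b : phase qt b i = (phase q i (cyc_next b))^-1.
Proof.
rewrite /phase -prodfV; under [RHS]eq_bigr do rewrite invf_div !ffunE ord_predK.
rewrite !prodf_div; congr (_ / _); rewrite -[RHS](cyc_reindex _ (fun s => q (i s) (b (ordS s)))).
by apply: eq_bigr => s _; rewrite ord_predK.
Qed.

(* Fixed vectors correspond to the eta which are invariant in b while eta/phase is
   invariant in i. The phase for the transpose is the inverse of the phase at the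
   rotated b, so that dividing by the phase exchanges the two conditions. *)
Definition transfer (eta : FX -> FY -> C) (b : FY) (i : FX) : C :=
  eta i (cyc_next b) / phase q i (cyc_next b).

Definition transfer_back (eta : FY -> FX -> C) (i : FX) (b : FY) : C :=
  eta (cyc_prev b) i * phase q i b.

Local Notation A := (@row_transform C X Y kY p).
Local Notation B := (@row_inverse C X Y kY p).
Local Notation At := (@row_transform C Y X kX p).
Local Notation Bt := (@row_inverse C Y X kX p).

Let qt_neq0 y x : qt y x != 0. Proof. exact: q_neq0. Qed.

Section Forward.
Variables (xi : FX -> FY -> C) (xi_fixed : model_fixed P xi).

Let etaX b i d : transfer (A xi) b (translate i d) = transfer (A xi) b i.
Proof.
exact: (row_transform_fixed kX_bichar kY_bichar q_neq0 eK e'K PE i (cyc_next b) d xi_fixed).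
Qed.

Let etaY b i y : transfer (A xi) (translate b y) i / phase qt (translate b y) i
  = transfer (A xi) b i / phase qt b i.
Proof.
rewrite !phase_next !invrK /transfer !divfK ?(phase_neq0 q_neq0) //.
by rewrite translate_next row_transform_translate.
Qed.

Lemma forward_fixed : model_fixed Pt (Bt (transfer (A xi))).
Proof. exact: (row_inverse_fixed kY_bichar kX_bichar qt_neq0 etK et'K PtE etaX etaY). Qed.

Lemma forwardK : B (transfer_back (At (Bt (transfer (A xi))))) =2 xi.
Proof.
move=> i a.
have -> : transfer_back (At (Bt (transfer (A xi)))) = A xi.
  apply/funext => j; apply/funext => b; rewrite /transfer_back.
  rewrite (row_inverseK kX_bichar (fun d => etaX _ _ d)) /transfer cyc_prevK.
  by rewrite divfK ?(phase_neq0 q_neq0).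
apply: (row_transformK kY_bichar) => t.
exact: (model_fixed_invariant kY_bichar PE).
Qed.
End Forward.

Section Backward.
Variables (xi : FY -> FX -> C) (xi_fixed : model_fixed Pt xi).

Let etaE i b : transfer_back (At xi) i b
  = At xi (cyc_prev b) i / phase qt (cyc_prev b) i.
Proof. by rewrite phase_next cyc_prevK invrK. Qed.

Let etaY i b y : transfer_back (At xi) i (translate b y) = transfer_back (At xi) i b.
Proof.
rewrite !etaE translate_prev.
exact: (row_transform_fixed kY_bichar kX_bichar qt_neq0 etK et'K PtE _ _ y xi_fixed).
Qed.

Let etaX i b d : transfer_back (At xi) (translate i d) b / phase q (translate i d) b
  = transfer_back (At xi) i b / phase q i b.
Proof.
by rewrite /transfer_back !mulfK ?(phase_neq0 q_neq0) // row_transform_translate.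
Qed.

Lemma backward_fixed : model_fixed P (B (transfer_back (At xi))).
Proof. exact: (row_inverse_fixed kX_bichar kY_bichar q_neq0 eK e'K PE etaY etaX). Qed.

Lemma backwardK : Bt (transfer (A (B (transfer_back (At xi))))) =2 xi.
Proof.
move=> b i.
have -> : transfer (A (B (transfer_back (At xi)))) = At xi.
  apply/funext => c; apply/funext => j; rewrite /transfer.
  rewrite (row_inverseK kY_bichar (fun y => etaY _ _ y)) /transfer_back cyc_nextK.
  by rewrite mulfK ?(phase_neq0 q_neq0).
apply: (row_transformK kX_bichar) => t.
exact: (model_fixed_invariant kX_bichar PtE).
Qed.
End Backward.

Variables (T : FX * FY -> FX * FY -> C) (Tt : FY * FX -> FY * FX -> C).
Hypothesis T_fixed : forall r, model_fixed P (fun i a => T (i, a) r).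
Hypothesis Tt_fixed : forall r, model_fixed Pt (fun b i => Tt (b, i) r).
Hypothesis T_id : forall xi, model_fixed P xi -> forall i a,
  \sum_r T (i, a) r * xi r.1 r.2 = xi i a.
Hypothesis Tt_id : forall xi, model_fixed Pt xi -> forall b i,
  \sum_r Tt (b, i) r * xi r.1 r.2 = xi b i.

(** The matrix of the linear map sending [xi] to [Bt (transfer (A xi))]: the argument of [transfer]
    is the row transform of the point mass at [r]. *)
Let fwd_kernel (s : FY * FX) (r : FX * FY) : C :=
  Bt (transfer (fun i b => \prod_k kY (r.2 k) (cyc_diff b k) * (i == r.1)%:R)) s.1 s.2.

Let bwd_kernel (r : FX * FY) (s : FY * FX) : C :=
  B (transfer_back (fun b i => \prod_k kX (s.2 k) (cyc_diff i k) * (b == s.1)%:R)) r.1 r.2.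

Let sum_pair_delta (U V : finType) (c : U * V -> C) u :
  \sum_r c r * (u == r.1)%:R = \sum_v c (u, v).
Proof.
transitivity (\sum_u' \sum_v c (u', v) * (u == u')%:R).
  by rewrite pair_bigA; apply: eq_bigr => -[].
rewrite (bigD1 u) //= [X in _ + X]big1 ?addr0 => [|w /negPf wu].
  by under eq_bigr do rewrite eqxx mulr1.
by rewrite big1 // => v _; rewrite eq_sym wu mulr0.
Qed.

Let fwd_kernelE xi b i : \sum_r fwd_kernel (b, i) r * xi r.1 r.2 = Bt (transfer (A xi)) b i.
Proof.
rewrite /fwd_kernel /row_inverse /= [RHS]mulr_sumr.
under eq_bigr do rewrite mulr_sumr mulr_suml.
rewrite exchange_big; apply: eq_bigr => j _ /=.
transitivity (\sum_(r : FX * FY) (#|X| ^ p.+2)%:R^-1 *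
    ((\prod_(k : I) kY (r.2 k) (cyc_diff (cyc_next b) k)
    / phase q j (cyc_next b)) / \prod_k kX (i k) (cyc_diff j k)) * xi r.1 r.2 * (j == r.1)%:R).
  by apply: eq_bigr => r _; rewrite /transfer; ring.
rewrite sum_pair_delta /transfer /row_transform !mulr_suml mulr_sumr.
by apply: eq_bigr => a _; ring.
Qed.

Let bwd_kernelE xi i a : \sum_s bwd_kernel (i, a) s * xi s.1 s.2 = B (transfer_back (At xi)) i a.
Proof.
rewrite /bwd_kernel /row_inverse /= [RHS]mulr_sumr.
under eq_bigr do rewrite mulr_sumr mulr_suml.
rewrite exchange_big; apply: eq_bigr => b _ /=.
transitivity (\sum_(s : FY * FX) (#|Y| ^ p.+2)%:R^-1 * ((\prod_(k : I) kX (s.2 k) (cyc_diff i k)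
    * phase q i b) / \prod_k kY (a k) (cyc_diff b k)) * xi s.1 s.2 * (cyc_prev b == s.1)%:R).
  by apply: eq_bigr => r _; rewrite /transfer_back; ring.
rewrite sum_pair_delta /transfer_back /row_transform !mulr_suml mulr_sumr.
by apply: eq_bigr => j _; ring.
Qed.

Lemma duality_trace : \sum_r T r r = \sum_s Tt s s.
Proof.
pose ft r := Bt (transfer (A (fun i a => T (i, a) r))).
pose bt r := B (transfer_back (At (fun b i => Tt (b, i) r))).
have fwdE r s : \sum_j fwd_kernel s j * T j r = ft r s.1 s.2.
  by case: s => b i; rewrite /ft -fwd_kernelE; apply: eq_bigr => -[].
have bwdE r s : \sum_j bwd_kernel s j * Tt j r = bt r s.1 s.2.
  by case: s => i a; rewrite /bt -bwd_kernelE; apply: eq_bigr => -[].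
apply: (@trace_comparison _ _ _ T Tt fwd_kernel bwd_kernel) => [r [i a]|r [b i]|r [b i]|r [i a]].
- by under eq_bigr do rewrite fwdE; rewrite bwd_kernelE forwardK.
- by under eq_bigr do rewrite bwdE; rewrite fwd_kernelE backwardK.
- under eq_bigr do rewrite fwdE.
  by rewrite fwdE; exact: (Tt_id (forward_fixed (T_fixed r))).
- under eq_bigr do rewrite bwdE.
  by rewrite bwdE; exact: (T_id (backward_fixed (Tt_fixed r))).
Qed.

End Duality.

(** * Equality of the moments *)

Section FourierBicharacter.
Variables (R : realType) (N : nat).
Local Notation C := R[i].
Local Notation w := (Defs.root_of_unity R N.+1).

Lemma root_of_unity_exp k : w ^+ k =
  (cos (2 * pi / N.+1%:R * k%:R) +i* sin (2 * pi / N.+1%:R * k%:R))%C.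
Proof.
elim: k => [|k IH]; first by rewrite expr0 mulr0 cos0 sin0.
set t := 2 * pi / N.+1%:R : R.
have -> : t * k.+1%:R = t * k%:R + t by rewrite -natr1 mulrDr mulr1.
rewrite exprSr IH cosD sinD /Defs.root_of_unity -/t; simpc.
by congr (_ +i* _)%C; rewrite addrC.
Qed.

Lemma root_of_unity_exp1 : w ^+ N.+1 = 1.
Proof.
by rewrite root_of_unity_exp divfK // mulrC mulr_natr cos2pi sin2pi.
Qed.

Lemma root_of_unity_exp_neq1 k : (0 < k < N.+1)%N -> w ^+ k != 1.
Proof.
move=> /andP[k0 kN]; rewrite root_of_unity_exp; apply/eqP => -[+ _].
(* Half the angle: it lies strictly between 0 and pi, where the sine is positive, so that cos 2t = 1
   - 2 sin^2 t < 1. *)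
set t := pi / N.+1%:R * k%:R : R.
have t_gt0 : 0 < t by rewrite !mulr_gt0 ?invr_gt0 ?ltr0n ?pi_gt0.
have t_lt : t < pi.
  by rewrite /t mulrAC ltr_pdivrMr // ltr_pM2l ?pi_gt0 // ltr_nat.
have -> : 2 * pi / N.+1%:R * k%:R = t *+ 2 by rewrite /t -[RHS]mulr_natr; ring.
have s_gt0 : 0 < sin t by rewrite sin_gt0_pi // t_gt0.
by rewrite cos_mulr2n cos2sin2; nra.
Qed.

Lemma root_of_unity_exp_mod k : w ^+ (k %% N.+1) = w ^+ k.
Proof. exact: expr_mod root_of_unity_exp1. Qed.

Definition fourier_kernel (i j : 'I_N.+1) : C := w ^+ (i * j)%N.

Lemma fourier_bicharacter : bicharacter fourier_kernel.
Proof.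
have w0 : w != 0.
  by apply: contra_eq_neq root_of_unity_exp1 => ->; rewrite expr0n eq_sym oner_eq0.
split=> [x y z|x y|x y|x]; rewrite /fourier_kernel.
- by rewrite -exprD -mulnDl -[LHS]root_of_unity_exp_mod modnMml root_of_unity_exp_mod.
- by rewrite mulnC.
- exact: expf_neq0.
rewrite card_ord; have [->|x0] := eqVneq x 0.
  by under eq_bigr do rewrite mul0n expr0; rewrite sumr_const card_ord mulr1.
rewrite mulr0; apply/eqP.
have wx1 : w ^+ x - 1 != 0.
  by rewrite subr_eq0 root_of_unity_exp_neq1 // ltn_ord lt0n andbT.
rewrite -(mulrI_eq0 _ (mulfI wx1)); apply/eqP.
under eq_bigr do rewrite exprM.
by rewrite -subrX1 -exprM mulnC exprM root_of_unity_exp1 expr1n subrr.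
Qed.

End FourierBicharacter.

Section Coordinates.
Variables (R : realType) (n : nat) (H : 'M[R[i]]_n.+1).
Hypothesis H_unit : forall x y, `|H x y| = 1.
Local Notation C := R[i].
Variables (G : hadamard_qgroup H) (h : {scalar G}) (h_haar : is_haar h).
Variables (X Y : finZmodType) (e : 'I_n.+1 -> X * Y) (e' : X * Y -> 'I_n.+1).
Hypotheses (eK : cancel e e') (e'K : cancel e' e).
Variable p : nat.
Local Notation FX := {ffun 'I_p.+1 -> X}.
Local Notation FY := {ffun 'I_p.+1 -> Y}.
Local Notation idx := {ffun 'I_p.+1 -> 'I_n.+1}.
Local Notation P := (@hadamard_proj R n.+1 H : 'I_n.+1 -> 'I_n.+1 -> 'M[C]_n.+1).

Definition pair_model (r s : X * Y) : 'M[C]_n.+1 := P (e' r) (e' s).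

Definition pair_idx (r : FX * FY) : idx := [ffun s => e' (r.1 s, r.2 s)].

Definition idx_pair (w : idx) : FX * FY :=
  ([ffun s => (e (w s)).1], [ffun s => (e (w s)).2]).

Lemma pair_idxK : cancel pair_idx idx_pair.
Proof.
by case=> i a; congr (_, _); apply/ffunP => s; rewrite !ffunE e'K.
Qed.

Lemma idx_pairK : cancel idx_pair pair_idx.
Proof. by move=> w; apply/ffunP => s; rewrite !ffunE /= -surjective_pairing eK. Qed.

Lemma sum_pair_idx (V : nmodType) (F : idx -> V) : \sum_w F w = \sum_r F (pair_idx r).
Proof. by rewrite (reindex pair_idx) //; exists idx_pair => w _; rewrite ?pair_idxK ?idx_pairK. Qed.

Definition pair_moment (r s : FX * FY) : C := haar_moment h (pair_idx r) (pair_idx s).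

Lemma multi_entry_pair i a j b :
  multi_entry P (pair_idx (i, a)) (pair_idx (j, b)) = model_word pair_model i a j b.
Proof. by apply: eq_bigr => s _; rewrite !ffunE. Qed.

Lemma pair_fix_defect (xi : FX -> FY -> C) :
  model_fixed pair_model xi <->
  forall w, fix_defect P (fun v => xi (idx_pair v).1 (idx_pair v).2) w = 0.
Proof.
have sumE i a : \sum_v xi (idx_pair v).1 (idx_pair v).2 *: multi_entry P (pair_idx (i, a)) v
    = \sum_j \sum_b xi j b *: model_word pair_model i a j b.
  rewrite sum_pair_idx pair_bigA; apply: eq_bigr => -[j b] _.
  by rewrite pair_idxK multi_entry_pair.
split=> [xi_fixed w|xi_fixed i a].
  rewrite -[w]idx_pairK; case: (idx_pair w) => i a.
  by rewrite /fix_defect sumE xi_fixed pair_idxK subrr.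
have := xi_fixed (pair_idx (i, a)); rewrite /fix_defect sumE pair_idxK => /eqP.
by rewrite subr_eq0 => /eqP.
Qed.

Lemma pair_moment_fixed r : model_fixed pair_model (fun i a => pair_moment (i, a) r).
Proof.
apply/pair_fix_defect => w.
rewrite -(model_fix_defect (haar_moment_invariant h_haar w (pair_idx r))).
rewrite /fix_defect /pair_moment; congr (_ - _ *: _).
  by apply: eq_bigr => v _; rewrite -surjective_pairing idx_pairK.
by rewrite -surjective_pairing idx_pairK.
Qed.

Lemma pair_moment_id (xi : FX -> FY -> C) : model_fixed pair_model xi ->
  forall i a, \sum_r pair_moment (i, a) r * xi r.1 r.2 = xi i a.
Proof.
move=> /pair_fix_defect/(haar_moment_fix H_unit h_haar) T_xi i a.
have := T_xi (pair_idx (i, a)); rewrite sum_pair_idx pair_idxK => <-.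
by apply: eq_bigr => r _; rewrite pair_idxK.
Qed.

Lemma main_char_moment : h (main_char G ^+ p.+1) = \sum_r pair_moment r r.
Proof.
rewrite -(sum_pair_idx (fun w => haar_moment h w w)) /haar_moment -linear_sum.
congr (h _); rewrite /main_char -[in LHS](card_ord p.+1) -prodr_const.
by rewrite (bigA_distr_bigA (fun (s : 'I_p.+1) k => @qg_coord R n.+1 H G k k)).
Qed.

End Coordinates.

Section HadamardDuality.
Variables (R : realType) (n : nat) (H Ht : 'M[R[i]]_n).
Local Notation C := R[i].
Hypothesis H_unit : forall x y, `|H x y| = 1.
Hypothesis Ht_unit : forall x y, `|Ht x y| = 1.
Variables (X Y : finZmodType) (kX : X -> X -> C) (kY : Y -> Y -> C) (q : X -> Y -> C).
Hypotheses (kX_bichar : bicharacter kX) (kY_bichar : bicharacter kY).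
Hypothesis q_neq0 : forall x y, q x y != 0.
Variables (e : 'I_n -> X * Y) (e' : X * Y -> 'I_n).
Hypotheses (eK : cancel e e') (e'K : cancel e' e).
Hypothesis HE : forall k l, H k l
  = q (e k).1 (e l).2 * kX (e k).1 (e l).1 * kY (e k).2 (e l).2.
Hypothesis HtE : forall k l, Ht k l
  = q (e l).1 (e k).2 * kY (e k).2 (e l).2 * kX (e k).1 (e l).1.
Variables (G : hadamard_qgroup H) (h : {scalar G}) (h_haar : is_haar h).
Variables (Gt : hadamard_qgroup Ht) (ht : {scalar Gt}) (ht_haar : is_haar ht).

Lemma main_char_moments p : h (main_char G ^+ p) = ht (main_char Gt ^+ p).
Proof.
(* Cyclic indices need at least one position, so the zeroth moment is treated apart. *)
case: p => [|p]; first by rewrite !expr0 (haar1 h_haar) (haar1 ht_haar).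
case: n H Ht H_unit Ht_unit e e' eK e'K HE HtE G h h_haar Gt ht ht_haar =>
  [|m] H0 Ht0 H0_unit Ht0_unit e0 e0' e0K e0'K H0E Ht0E G0 h0 h0_haar Gt0 ht0 ht0_haar.
  (* Size 0 is impossible, as X * Y contains (0, 0). *)
  by case: (e0' (0, 0)).
pose et k := ((e0 k).2, (e0 k).1); pose et' (z : Y * X) := e0' (z.2, z.1).
have etK : cancel et et' by move=> k; rewrite /et' /et -surjective_pairing e0K.
have et'K : cancel et' et by case=> y x; rewrite /et' /et e0'K.
rewrite (main_char_moment h0 e0K e0'K) (main_char_moment ht0 etK et'K).
apply: (duality_trace kX_bichar kY_bichar q_neq0 e0K e0'K etK et'K
  (P := pair_model H0 e0') (Pt := pair_model Ht0 et')).
- move=> r s k l; rewrite /pair_model hadamard_projE // !H0E !e0'K /ratio_row.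
  rewrite !(bicharB kX_bichar) !(bicharB kY_bichar).
  set c := m.+1%:R^-1; by field; rewrite !q_neq0 !(bichar_neq0 kX_bichar) !(bichar_neq0 kY_bichar).
- move=> r s k l; rewrite /pair_model hadamard_projE // !Ht0E !e0'K /ratio_row /=.
  rewrite !(bicharB kX_bichar) !(bicharB kY_bichar).
  set c := m.+1%:R^-1; by field; rewrite !q_neq0 !(bichar_neq0 kX_bichar) !(bichar_neq0 kY_bichar).
- exact: pair_moment_fixed.
- exact: pair_moment_fixed.
- exact: pair_moment_id.
- exact: pair_moment_id.
Qed.

End HadamardDuality.

(** * From moments to laws *)

Section Bernstein.
Variable R : realType.
Implicit Types (phi : nat -> R) (t : R).

(* The expectation of phi(k) for k binomially distributed with parameters m and t,
   computed by conditioning on the first trial. *)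
Fixpoint bernstein (m : nat) (phi : nat -> R) : {poly R} :=
  if m is m'.+1 then
    (1 - 'X) * bernstein m' phi + 'X * bernstein m' (fun k => phi k.+1)
  else (phi 0%N)%:P.

Lemma bernsteinS m phi t : (bernstein m.+1 phi).[t]
  = (1 - t) * (bernstein m phi).[t] + t * (bernstein m (fun k => phi k.+1)).[t].
Proof. by rewrite /= !hornerE. Qed.

Lemma bernstein_le m phi psi t : 0 <= t <= 1 ->
  (forall k, (k <= m)%N -> phi k <= psi k) -> (bernstein m phi).[t] <= (bernstein m psi).[t].
Proof.
move=> /andP[t0 t1]; elim: m phi psi => [|m IH] phi psi le_phi.
  by rewrite /= !hornerC le_phi.
rewrite !bernsteinS lerD // ler_wpM2l ?subr_ge0 // IH // => k km.
  by rewrite le_phi // ltnW.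
by rewrite le_phi.
Qed.

(** Mean m t and variance m t (1 - t) of the binomial distribution; the induction moves x, as a
    success in the first trial replaces x by x - 1. *)
Lemma bernstein_square m (a b x : R) t :
  (bernstein m (fun k => a + b * (x - k%:R) ^+ 2)).[t]
    = a + b * ((x - m%:R * t) ^+ 2 + m%:R * t * (1 - t)).
Proof.
elim: m x => [|m IH] x; first by rewrite /= hornerC !mul0r subr0 addr0.
rewrite bernsteinS IH.
have -> : (fun k => a + b * (x - k.+1%:R) ^+ 2) = (fun k => a + b * (x - 1 - k%:R) ^+ 2).
  by apply/funext => k; rewrite -natr1; ring.
by rewrite IH -natr1; ring.
Qed.

Lemma bernsteinB m phi (c : R) t :
  (bernstein m (fun k => phi k - c)).[t] = (bernstein m phi).[t] - c.
Proof.
elim: m phi => [|m IH] phi; first by rewrite /= !hornerC.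
by rewrite !bernsteinS !IH; ring.
Qed.

Lemma bernsteinN m phi t : (bernstein m (fun k => - phi k)).[t] = - (bernstein m phi).[t].
Proof.
elim: m phi => [|m IH] phi; first by rewrite /= !hornerC.
by rewrite !bernsteinS !IH; ring.
Qed.

(** A quadratic bound instead of a modulus of continuity, because the binomial expectation of a
    square is known exactly. *)
Lemma within_continuous_modulus (b : R) (g : R -> R) (eps : R) :
  0 <= b -> {within `[0, b], continuous g} -> 0 < eps ->
  exists2 K : R, 0 <= K & forall x y, 0 <= x <= b -> 0 <= y <= b ->
    `|g x - g y| <= eps + K * (x - y) ^+ 2.
Proof.
move=> b0 cg eps0.
(* Uniform continuity, by compactness of the interval. *)
have unif : \forall d \near 0^'+, `[0, b] `<=`
    [set x | forall y, 0 <= y <= b -> `|x - y| < d -> 0 <= x <= b -> `|g x - g y| < eps].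
  apply: (compact_near_coveringP _).1 => [|x xb]; first exact: segment_compact.
  have /cvgrPdist_lt gx := (subspace_continuousP _ _).1 cg x xb.
  have /gx : 0 < eps / 2 by rewrite divr_gt0.
  rewrite near_withinE => -[eta /= eta0 g_eta].
  have eta20 : 0 < eta / 2 by rewrite divr_gt0.
  exists (ball x (eta / 2), [set d | d < eta / 2]).
    split => /=; first exact: nbhsx_ballx.
    exact: nbhs_right_lt.
  move=> [x' d] /= [xx' d_lt] y yb x'y x'b.
  have near_x z : 0 <= z <= b -> `|x - z| < eta -> `|g x - g z| < eps / 2.
    by move=> zb xz; apply: g_eta => //=; rewrite in_itv.
  have xx'_lt : `|x - x'| < eta / 2 by rewrite -ball_normE in xx'.
  rewrite (le_lt_trans (ler_distD (g x) _ _)) // [ltRHS]splitr ltrD //.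
    by rewrite distrC near_x // (lt_trans xx'_lt) // ltr_pdivrMr // ltr_pMr // ltr1n.
  rewrite near_x // (le_lt_trans (ler_distD x' _ _)) // [ltRHS]splitr ltrD //.
  exact: lt_trans x'y d_lt.
have [c1 _ gc1] := EVT_max b0 cg.
have [c2 _ gc2] := EVT_min b0 cg.
have [d [d0 gd]] : exists d : R, 0 < d /\ forall x y, 0 <= x <= b -> 0 <= y <= b ->
    `|x - y| < d -> `|g x - g y| < eps.
  have [d d0 dP] : exists2 d : R, 0 < d & `[0, b] `<=`
    [set x | forall y, 0 <= y <= b -> `|x - y| < d -> 0 <= x <= b -> `|g x - g y| < eps].
    near (0:R)^'+ => d; exists d; near: d => //.
    exact: nbhs_right_gt.
  by exists d; split=> // x y xb yb xy; apply: dP => //=; rewrite in_itv.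
have b_in : (0 : R) \in `[0, b] by rewrite in_itv /= lexx b0.
(* Closer than d, uniform continuity gives eps; farther away, (x - y)^2 / d^2 is at least 1 and the
   total oscillation suffices. *)
exists ((g c1 - g c2) / d ^+ 2) => [|x y xb yb].
  by rewrite divr_ge0 ?sqr_ge0 // subr_ge0 (le_trans (gc2 _ b_in)) // gc1.
have osc : `|g x - g y| <= g c1 - g c2.
  have [xI yI] : x \in `[0, b] /\ y \in `[0, b] by rewrite !in_itv.
  rewrite ler_norml opprB !lerB ?gc1 ?gc2 //.
have osc0 : 0 <= g c1 - g c2 by exact: le_trans osc.
have [xy|xy] := ltP `|x - y| d.
  rewrite (le_trans (ltW (gd _ _ xb yb xy))) // lerDl.
  by rewrite mulr_ge0 ?sqr_ge0 // divr_ge0 ?sqr_ge0.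
apply: (le_trans osc); apply: ler_wpDl; first exact: ltW.
rewrite mulrAC ler_pdivlMr ?exprn_gt0 // ler_wpM2l // -[leRHS]real_normK ?num_real //.
by rewrite ler_pXn2r ?nnegrE // ltW.
Unshelve. all: by end_near. Qed.

Lemma weierstrass_approximation (b : R) (g : R -> R) (eps : R) :
  0 < b -> {within `[0, b], continuous g} -> 0 < eps ->
  exists p : {poly R}, forall x, 0 <= x <= b -> `|g x - p.[x]| <= eps.
Proof.
move=> b0 cg eps0.
have eps20 : 0 < eps / 2 by rewrite divr_gt0.
have [K K0 gK] := within_continuous_modulus (ltW b0) cg eps20.
(* Large enough for the variance to contribute at most K b^2 / m <= eps / 2. *)
pose m := (Num.truncn (K * b ^+ 2 / (eps / 2))).+1.
have m_gt : K * b ^+ 2 / (eps / 2) < m%:R by exact: truncnS_gt.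
have m0 : 0 < m%:R :> R by rewrite ltr0n.
pose phi k := g (b * (k%:R / m%:R)).
exists (bernstein m phi \Po (b^-1 *: 'X)) => x /andP[x0 xb].
rewrite horner_comp hornerZ hornerX; set t := b^-1 * x.
have t01 : 0 <= t <= 1.
  by rewrite /t [b^-1 * x]mulrC divr_ge0 ?(ltW b0) //= ler_pdivrMr ?mul1r.
have xE : x = b * t by rewrite /t mulVKf // gt_eqF.
pose c := K * b ^+ 2 / m%:R ^+ 2.
have phi_bound k : (k <= m)%N -> `|g x - phi k| <= eps / 2 + c * (m%:R * t - k%:R) ^+ 2.
  move=> km; have kb : 0 <= b * (k%:R / m%:R) <= b.
    by rewrite mulr_ge0 ?divr_ge0 ?(ltW b0) //= ger_pMr // ler_pdivrMr // mul1r ler_nat.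
  rewrite (le_trans (gK x _ _ kb)) ?x0 // lerD2l xE /c.
  have -> : b * t - b * (k%:R / m%:R) = b / m%:R * (m%:R * t - k%:R).
    by field; rewrite gt_eqF.
  by rewrite exprMn expr_div_n !mulrA.
have total : eps / 2 + c * ((m%:R * t - m%:R * t) ^+ 2 + m%:R * t * (1 - t)) <= eps.
  rewrite subrr expr0n add0r [leRHS]splitr lerD2l.
  have -> : c * (m%:R * t * (1 - t)) = K * b ^+ 2 / m%:R * (t * (1 - t)).
    by rewrite /c; field; rewrite gt_eqF.
  have Kb0 : 0 <= K * b ^+ 2 / m%:R by rewrite !mulr_ge0 ?invr_ge0 ?sqr_ge0 // ltW.
  rewrite (@le_trans _ _ (K * b ^+ 2 / m%:R)) //.
    by rewrite ler_piMr //; case/andP: t01 => t0 t1; nra.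
  rewrite ler_pdivrMr // -ler_pdivrMl ?divr_gt0 // mulrC ltW //.
(* The Bernstein operator is monotone and commutes with subtracting constants: each half of the
   bound on g x - phi k passes to the polynomial. *)
rewrite distrC ler_norml; apply/andP; split.
  rewrite -lerN2 opprK opprB -(opprB _ (g x)) -bernsteinB -bernsteinN.
  apply: le_trans total; rewrite -bernstein_square; apply: bernstein_le => // k km.
  by rewrite opprB; apply: le_trans (phi_bound k km); exact: ler_norm.
rewrite -bernsteinB; apply: le_trans total; rewrite -bernstein_square.
apply: bernstein_le => // k km; apply: le_trans (phi_bound k km).
by rewrite distrC ler_norm.
Qed.

End Bernstein.

Section ContinuousFunctions.
Variables (R : realType) (n : nat).
Local Notation C := R[i].
Local Notation I := (`[(0 : R), n%:R]%classic).

Lemma continuous_uptoE (f : R -> C^o) : continuous_upto n f <->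
  {within I, continuous (fun x : R => complex.Re (f x))} /\
  {within I, continuous (fun x : R => complex.Im (f x))}.
Proof.
rewrite /continuous_upto; split=> [/subspace_continuousP cf|].
  split; apply/subspace_continuousP => x /cf/cvgrPdist_lt fx; apply/cvgrPdist_lt => e e0.
    have e0' : 0 < e%:C%C by rewrite ltcR.
    apply: filterS (fx _ e0') => y; rewrite -absCE ltcR -(raddfB (@complex.Re R)).
    by apply: le_lt_trans; exact: absC_Re.
  have e0' : 0 < e%:C%C by rewrite ltcR.
  apply: filterS (fx _ e0') => y; rewrite -absCE ltcR -(raddfB (@complex.Im R)).
  by apply: le_lt_trans; exact: absC_Im.
move=> [/subspace_continuousP cRe /subspace_continuousP cIm].
apply/subspace_continuousP => x xI; apply/cvgrPdist_lt => e e0.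
have [r r0 ->] : exists2 r : R, 0 < r & e = r%:C%C.
  exists (complex.Re e); last by rewrite RRe_real // gtr0_real.
  by rewrite -ltcR RRe_real // gtr0_real.
have r20 : 0 < r / 2 by rewrite divr_gt0.
have /cvgrPdist_lt/(_ _ r20) fRe := cRe x xI.
have /cvgrPdist_lt/(_ _ r20) fIm := cIm x xI.
near=> y; rewrite -absCE ltcR (le_lt_trans (absC_le_ReIm _)) // [ltRHS]splitr.
rewrite (raddfB (@complex.Re R)) (raddfB (@complex.Im R)) ltrD //; near: y.
  exact: fRe.
exact: fIm.
Unshelve. all: by end_near. Qed.

Lemma continuous_upto_real (g : R -> R) : {within I, continuous g} ->
  continuous_upto n (fun x => (g x)%:C%C).
Proof.
move=> cg; apply/continuous_uptoE; split=> //=.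
by move=> x; exact: cvg_cst.
Qed.

End ContinuousFunctions.

(** * Positive functionals on the functional calculus *)

Section PositiveFunctional.
Variables (R : realType) (A : cstarAlgType R) (n : nat) (a : A).
Local Notation C := R[i].
Local Notation I := (`[(0 : R), n%:R]%classic).
Variables (Phi : (R -> C^o) -> A) (Phi_calc : is_functional_calculus n a Phi).
Variables (h : {scalar A}) (h1 : h 1 = 1) (h_pos : forall x, 0 <= h (adj x * x)).

(** A nonnegative g is the square of the real function sqrt g, so its image has the form s^* s. *)
Lemma fcalc_real_ge0 (g : R -> R) : {within I, continuous g} ->
  (forall x, 0 <= x <= n%:R -> 0 <= g x) -> 0 <= h (Phi (fun x => (g x)%:C%C)).
Proof.
move=> cg g0; pose s x : C^o := (Num.sqrt (g x))%:C%C.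
have cs : continuous_upto n s.
  apply: continuous_upto_real; apply: within_continuous_comp cg => y _.
  exact: sqrt_continuous.
have sJ : (fun x => (s x)^*) = s.
  by apply/funext => x; apply: conj_Creal; apply/complex_realP; exists (Num.sqrt (g x)).
have -> : Phi (fun x => (g x)%:C%C) = adj (Phi s) * Phi s.
  rewrite -(fcalc_adj Phi_calc cs) sJ -(fcalcM Phi_calc cs cs).
  apply: (fcalc_ext Phi_calc); first exact: continuous_upto_real.
    have -> : (fun x => s x * s x) = (fun x => (Num.sqrt (g x) * Num.sqrt (g x))%:C%C).
      by apply/funext => x; rewrite rmorphM.
    apply: continuous_upto_real => x; apply: cvgM; apply: within_continuous_comp cg x => y _;
      exact: sqrt_continuous.
  by move=> x /g0 gx; rewrite -rmorphM -expr2 sqr_sqrtr.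
exact: h_pos.
Qed.

(** Positivity at eps - (f - g) and eps - (g - f), together with h 1 = 1. *)
Lemma fcalc_real_dist (f g : R -> R) (eps : R) :
  {within I, continuous f} -> {within I, continuous g} ->
  (forall x, 0 <= x <= n%:R -> `|f x - g x| <= eps) ->
  `|h (Phi (fun x => (f x)%:C%C)) - h (Phi (fun x => (g x)%:C%C))| <= eps%:C%C.
Proof.
move=> cf cg fg.
have cc : {within I, continuous (fun=> eps : R)} by move=> x; exact: cvg_cst.
have cN : {within I, continuous (fun x : R => - g x)} by move=> x; apply: cvgN; exact: cg.
have PhiN (u : R -> R) : {within I, continuous u} ->
    Phi (fun x => (- u x)%:C%C) = - Phi (fun x => (u x)%:C%C).
  move=> cu; rewrite -scaleN1r -(fcalcZ Phi_calc); last exact: continuous_upto_real.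
  by congr Phi; apply/funext => x; rewrite rmorphN mulN1r.
have PhiB (u v : R -> R) : {within I, continuous u} ->
    {within I, continuous v} ->
    Phi (fun x => (u x - v x)%:C%C) = Phi (fun x => (u x)%:C%C) - Phi (fun x => (v x)%:C%C).
  move=> cu cv; have cNv : {within I, continuous (fun x : R => - v x)}.
    by move=> x; apply: cvgN; exact: cv.
  rewrite -(PhiN _ cv) -(fcalcD Phi_calc); try exact: continuous_upto_real.
  by congr Phi; apply/funext => x; rewrite rmorphD.
have Phi_eps : h (Phi (fun=> eps%:C%C)) = eps%:C%C.
  have -> : (fun=> eps%:C%C) = (fun x : R => eps%:C%C * (1 : C^o)).
    by apply/funext => x; rewrite mulr1.
  rewrite (fcalcZ Phi_calc); last first.
    by apply: (@continuous_upto_real _ _ (fun=> 1)) => x; exact: cvg_cst.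
  by rewrite (fcalc1 Phi_calc) linearZ /= h1 mulr1.
have cfg : {within I, continuous (fun x : R => f x - g x)}.
  by move=> x; apply: cvgB; [exact: cf | exact: cg].
have cgf : {within I, continuous (fun x : R => g x - f x)}.
  by move=> x; apply: cvgB; [exact: cg | exact: cf].
have le1 : h (Phi (fun x => (f x)%:C%C)) - h (Phi (fun x => (g x)%:C%C)) <= eps%:C%C.
  rewrite -subr_ge0 -{1}Phi_eps -!linearB /= -(PhiB _ _ cf cg) -(PhiB _ _ cc cfg).
  apply: fcalc_real_ge0 => [x|x xn]; first by apply: cvgB; [exact: cc | exact: cfg].
  by rewrite subr_ge0; exact: le_trans (ler_norm _) (fg x xn).
have le2 : h (Phi (fun x => (g x)%:C%C)) - h (Phi (fun x => (f x)%:C%C)) <= eps%:C%C.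
  rewrite -subr_ge0 -{1}Phi_eps -!linearB /= -(PhiB _ _ cg cf) -(PhiB _ _ cc cgf).
  apply: fcalc_real_ge0 => [x|x xn]; first by apply: cvgB; [exact: cc | exact: cgf].
  by rewrite subr_ge0 (le_trans (ler_norm _)) // distrC fg.
rewrite real_ler_norml; first by rewrite le1 lerNl opprB le2.
by rewrite (ler_real le1); apply/complex_realP; exists eps.
Qed.

Lemma continuous_upto_poly (p : {poly R}) : {within I, continuous (fun x : R => p.[x])}.
Proof.
elim/poly_ind: p => [|p c IH].
  by have -> : (fun x => (0 : {poly R}).[x]) = (fun=> 0) by [apply/funext => x; rewrite horner0];
    move=> x; exact: cvg_cst.
have -> : (fun x => (p * 'X + c%:P).[x]) = (fun x => p.[x] * x + c).
  by apply/funext => x; rewrite !hornerE.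
move=> x; apply: cvgD; last exact: cvg_cst.
apply: cvgM; first exact: IH.
by apply: continuous_subspaceT => y; exact: cvg_id.
Qed.

Lemma fcalc_poly_ind (p : {poly R}) (c : R) :
  Phi (fun x => ((p * 'X + c%:P).[x])%:C%C)
    = Phi (fun x => (p.[x])%:C%C) * a + c%:C%C *: 1.
Proof.
have cid : continuous_upto n (fun x : R => x%:C%C).
  by apply: continuous_upto_real; apply: continuous_subspaceT => y; exact: cvg_id.
have c1 : continuous_upto n (fun=> (1 : C^o)).
  by apply: (@continuous_upto_real _ _ (fun=> 1)) => x; exact: cvg_cst.
have cp : continuous_upto n (fun x => (p.[x])%:C%C).
  have := @continuous_upto_real R n (fun x => p.[x]) (@continuous_upto_poly p).
  exact.
rewrite -(fcalc_id Phi_calc) -(fcalc1 Phi_calc) -(fcalcZ Phi_calc _ c1).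
rewrite -(fcalcM Phi_calc cp cid) -(fcalcD Phi_calc).
- by congr Phi; apply/funext => x; rewrite !hornerE rmorphD rmorphM /= ?mulr1.
- have -> : (fun x => p.[x]%:C%C * x%:C%C) = (fun x => ((p * 'X).[x])%:C%C :> C^o).
    by apply/funext => x; rewrite !hornerE rmorphM.
  have := @continuous_upto_real R n (fun x => (p * 'X).[x]) (@continuous_upto_poly _).
  exact.
have -> : (fun=> c%:C%C * 1) = (fun=> (c%:C%C : C^o)) :> (R -> C^o).
  by apply/funext => x; rewrite mulr1.
by apply: continuous_upto_real => x; exact: cvg_cst.
Qed.

End PositiveFunctional.

Section MomentDeterminacy.
Variables (R : realType) (n : nat) (n_gt0 : (0 < n)%N).
Local Notation C := R[i].
Local Notation I := (`[(0 : R), n%:R]%classic).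
Variables (A A' : cstarAlgType R) (a : A) (a' : A').
Variables (Phi : (R -> C^o) -> A) (Phi_calc : is_functional_calculus n a Phi).
Variables (Phi' : (R -> C^o) -> A') (Phi'_calc : is_functional_calculus n a' Phi').
Variables (h : {scalar A}) (h1 : h 1 = 1) (h_pos : forall x, 0 <= h (adj x * x)).
Variables (h' : {scalar A'}) (h'1 : h' 1 = 1) (h'_pos : forall x, 0 <= h' (adj x * x)).
Hypothesis moments : forall k, h (a ^+ k) = h' (a' ^+ k).

Lemma fcalc_poly_eq (p : {poly R}) :
  h (Phi (fun x => (p.[x])%:C%C)) = h' (Phi' (fun x => (p.[x])%:C%C)).
Proof.
(* The factor [a ^+ k] absorbs the powers that Horner's scheme produces: the step from p to p X + c
   uses the hypothesis at k + 1. *)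
suff eq_k k : h (Phi (fun x => (p.[x])%:C%C) * a ^+ k)
    = h' (Phi' (fun x => (p.[x])%:C%C) * a' ^+ k).
  by have := eq_k 0%N; rewrite !expr0 !mulr1.
elim/poly_ind: p k => [|p c IH] k.
  have zeroE (B : cstarAlgType R) (b : B) (Psi : (R -> C^o) -> B) :
      is_functional_calculus n b Psi -> Psi (fun x => ((0 : {poly R}).[x])%:C%C) = 0.
    move=> Psi_calc; rewrite -(scale0r (1 : B)) -(fcalc1 Psi_calc) -(fcalcZ Psi_calc).
      by congr Psi; apply/funext => x; rewrite horner0 mul0r.
    by apply: (@continuous_upto_real _ _ (fun=> 1)) => x; exact: cvg_cst.
  by rewrite (zeroE _ _ _ Phi_calc) (zeroE _ _ _ Phi'_calc) !mul0r !linear0.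
rewrite (fcalc_poly_ind Phi_calc) (fcalc_poly_ind Phi'_calc) !mulrDl.
rewrite -!scalerAl !mul1r -!mulrA -!exprS !linearD !linearZ /=.
by rewrite IH moments.
Qed.

Lemma fcalc_real_eq (g : R -> R) : {within I, continuous g} ->
  h (Phi (fun x => (g x)%:C%C)) = h' (Phi' (fun x => (g x)%:C%C)).
Proof.
move=> cg; apply/eqP; rewrite -subr_eq0 -normr_eq0 -absCE; apply/eqP; congr (_%:C)%C.
apply/eqP; rewrite eq_le absC_ge0 andbT; apply/ler_addgt0Pl => e e0; rewrite addr0.
have e20 : 0 < e / 2 by rewrite divr_gt0.
have n0 : 0 < n%:R :> R by rewrite ltr0n.
have [p gp] := weierstrass_approximation n0 cg e20.
have cp := @continuous_upto_poly R n p.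
have d := fcalc_real_dist Phi_calc h1 h_pos cg cp gp.
have d' := fcalc_real_dist Phi'_calc h'1 h'_pos cg cp gp.
rewrite -lecR absCE -(subrK (h (Phi (fun x => (p.[x])%:C%C))) (h (Phi _))) -addrA.
rewrite (le_trans (ler_normD _ _)) // [e]splitr rmorphD lerD //.
by rewrite fcalc_poly_eq distrC.
Qed.

Lemma fcalc_eq (f : R -> C^o) : continuous_upto n f -> h (Phi f) = h' (Phi' f).
Proof.
move=> /continuous_uptoE[cRe cIm].
have split_calc (B : cstarAlgType R) (b : B) (Psi : (R -> C^o) -> B) (k : {scalar B}) :
    is_functional_calculus n b Psi ->
    k (Psi f) = k (Psi (fun x => (complex.Re (f x))%:C%C))
      + 'i%C * k (Psi (fun x => (complex.Im (f x))%:C%C)).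
  move=> Psi_calc; have fE : f = (fun x =>
      (complex.Re (f x))%:C%C + 'i%C * (complex.Im (f x))%:C%C).
    by apply/funext => x; rewrite -complexE.
  rewrite {1}fE (fcalcD Psi_calc) ?(fcalcZ Psi_calc) ?linearD ?linearZ //.
  - exact: continuous_upto_real.
  - exact: continuous_upto_real.
  apply/continuous_uptoE; split.
    have -> : (fun x => complex.Re ('i%C * (complex.Im (f x))%:C%C)) = (fun=> 0).
      by apply/funext => x; simpc.
    by move=> x; exact: cvg_cst.
  have -> : (fun x => complex.Im ('i%C * (complex.Im (f x))%:C%C)) = (fun x => complex.Im (f x)).
    by apply/funext => x; simpc.
  exact: cIm.
rewrite (split_calc _ _ _ _ Phi_calc) (split_calc _ _ _ _ Phi'_calc).
by rewrite !fcalc_real_eq.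
Qed.

End MomentDeterminacy.

(** * Laws determined by the integrals of continuous functions *)

Section LawUniqueness.
Variables (R : realType) (b : R).
Local Notation I := (`[(0 : R), b]%classic).
Implicit Types (mu nu : probability R R) (c : R).

(** For k > 0 this is 1 up to c - 1/k, 0 from c on and affine between: a continuous function
    squeezed between the indicators of two rays. *)
Definition ramp (c k x : R) : R := Num.min 1 (Num.max 0 (k * (c - x))).

Lemma ramp_continuous c k : continuous (ramp c k).
Proof.
have affine : continuous (fun x => k * (c - x)).
  move=> x; apply: cvgM; first exact: cvg_cst.
  by apply: cvgB; [exact: cvg_cst | exact: cvg_id].
move=> x; apply: (@continuous_min _ _ (fun=> 1) (fun x => Num.max 0 (k * (c - x)))).
  exact: cvg_cst.
apply: (@continuous_max _ _ (fun=> 0) (fun x => k * (c - x))); first exact: cvg_cst.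
exact: affine.
Qed.

Lemma ramp_ge0 c k x : 0 <= ramp c k x.
Proof. by rewrite /ramp le_min ler01 le_max lexx. Qed.

Lemma ramp_le_indic c k x : 0 < k -> ramp c k x <= \1_(`]-oo, c[) x.
Proof.
move=> k0; rewrite indicE /ramp; have [xc|xc] := ltP x c.
  by rewrite mem_set ?in_itv //= ge_min lexx.
rewrite memNset ?in_itv /=; last by apply/negP; rewrite -leNgt.
by rewrite ge_min ge_max lexx /= orbC mulr_ge0_le0 ?(ltW k0) ?subr_le0.
Qed.

Lemma indic_le_ramp c k x : 0 < k -> \1_(`]-oo, (c - k^-1)]) x <= ramp c k x.
Proof.
move=> k0; rewrite indicE /ramp; have [xc|xc] := leP x (c - k^-1).
  rewrite mem_set ?in_itv //= le_min lexx le_max; apply/orP; right.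
  by rewrite -ler_pdivrMl // mulr1 lerBrDl addrC -lerBrDl.
rewrite memNset ?in_itv /=; last by apply/negP; rewrite -ltNge.
exact: ramp_ge0.
Qed.

Lemma measure_carrier mu (A : set R) : mu I = 1%E -> measurable A -> mu A = mu (A `&` I).
Proof.
move=> muI mA; have mI : measurable I by exact: measurable_itv.
have I0 : mu (~` I) = 0%E by rewrite probability_setC // muI subee.
have mIC : measurable (~` I) by exact: measurableC.
have disjIC : (A `&` I) `&` (A `&` ~` I) = set0 by rewrite setIACA setICr setI0.
rewrite -[in LHS](setIT A) -(setUv I) setIUr.
rewrite (measureU mu (measurableI _ _ mA mI) (measurableI _ _ mA mIC) disjIC).
rewrite [X in (_ + X)%E](_ : _ = 0%E) ?adde0 //; apply/eqP; rewrite eq_le measure_ge0 andbT.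
rewrite -I0; apply: le_measure; last exact: subIsetr.
  exact: (mem_set (measurableI _ _ mA mIC)).
exact: mem_set.
Qed.

Lemma ramp_integral mu c k : 0 < k -> mu I = 1%E ->
  (mu `]-oo, (c - k^-1)%R]%classic <= (\int[mu]_(x in I) ramp c k x)%:E)%E /\
  ((\int[mu]_(x in I) ramp c k x)%:E <= mu `]-oo, c[%classic)%E.
Proof.
move=> k0 muI; have mI : measurable I by exact: measurable_itv.
have m_ramp : measurable_fun I (ramp c k).
  by apply: measurable_funTS; apply: continuous_measurable_fun; exact: ramp_continuous.
have int_le : (\int[mu]_(x in I) (ramp c k x)%:E <= mu `]-oo, c[%classic)%E.
  rewrite (measure_carrier muI) ?measurable_itv // -integral_indic // ?measurable_itv //.
  apply: ge0_le_integral => //.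
  - by move=> x _; rewrite lee_fin ramp_ge0.
  - exact/measurable_EFinP.
  - by apply/measurable_EFinP; exact: measurable_indic.
  - by move=> x _; rewrite lee_fin ramp_le_indic.
have int_fin : (\int[mu]_(x in I) (ramp c k x)%:E)%E \is a fin_num.
  rewrite ge0_fin_numE; last by apply: integral_ge0 => x _; rewrite lee_fin ramp_ge0.
  exact: (le_lt_trans int_le (le_lt_trans (probability_le1 _ _) (ltry _))).
rewrite /Rintegral fineK //; split=> //.
rewrite (measure_carrier muI) ?measurable_itv // -integral_indic // ?measurable_itv //.
apply: ge0_le_integral => //.
- by apply/measurable_EFinP; exact: measurable_indic.
- exact/measurable_EFinP.
- by move=> x _; rewrite lee_fin indic_le_ramp.
Qed.

(** The open rays generate the Borel sets and are stable under intersection. The ramps compare the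
    two measures of a ray in the limit of infinite slope, in either direction by symmetry. *)
Lemma law_unique mu nu : mu I = 1%E -> nu I = 1%E ->
  (forall g : R -> R, {within I, continuous g} ->
    \int[mu]_(x in I) g x = \int[nu]_(x in I) g x) ->
  forall A : set R, measurable A -> mu A = nu A.
Proof.
have half mu' nu' c : mu' I = 1%E -> nu' I = 1%E ->
    (forall g : R -> R, {within I, continuous g} ->
      \int[mu']_(x in I) g x = \int[nu']_(x in I) g x) ->
    (mu' `]-oo, c[%classic <= nu' `]-oo, c[%classic)%E.
  move=> muI nuI int_eq; pose F k := `]-oo, (c - k.+1%:R^-1)%R]%classic : set R.
  have FE : \bigcup_k F k = `]-oo, c[%classic.
    apply/seteqP; split=> [x [k _]|x] /=; rewrite !in_itv /=.
      by rewrite /F /= in_itv => /= xk; apply: (le_lt_trans xk); rewrite ltrBlDr ltrDl invr_gt0.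
    rewrite -subr_gt0 => xc; have [k kP] : exists k, (c - x)^-1 < k.+1%:R.
      by exists (Num.truncn (c - x)^-1); exact: truncnS_gt.
    exists k => //; rewrite /F /= in_itv /= lerBrDr -lerBrDl.
    by rewrite invf_ple ?posrE // ltW.
  have F_cvg : mu' \o F @ \oo --> mu' (\bigcup_k F k).
    apply: nondecreasing_cvg_mu => [k||k l kl].
    - exact: measurable_itv.
    - by rewrite FE; exact: measurable_itv.
    apply/subsetPset => x; rewrite /F /= !in_itv /= => xk; apply: (le_trans xk).
    by rewrite lerB // lef_pV2 ?posrE // ler_nat.
  rewrite -FE -(cvg_lim _ F_cvg) // FE; apply: lime_le.
    by apply/cvg_ex; eexists; exact: F_cvg.
  apply: nearW => k /=.
  have k0 : 0 < k.+1%:R :> R by rewrite ltr0n.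
  apply: le_trans (ramp_integral c k0 muI).1 _.
  rewrite int_eq; first exact: (ramp_integral c k0 nuI).2.
  by apply: continuous_subspaceT; exact: ramp_continuous.
move=> muI nuI int_eq A mA.
have raysI : setI_closed (@RGenInftyO.G R).
  move=> _ _ [x ->] [y ->]; exists (Num.min x y); apply/seteqP; split=> z /=;
    rewrite !in_itv /= lt_min; first by case=> -> ->.
  by move=> /andP.
(* An exhausting sequence of rays of finite measure, as uniqueness of the extension requires. *)
have rays k : @RGenInftyO.G R `]-oo, k%:R[%classic by exists k%:R.
have cover : \bigcup_k `]-oo, (k%:R : R)[%classic = setT.
  apply/seteqP; split=> // x _; exists (Num.truncn x).+1 => //=.
  by rewrite in_itv /= truncnS_gt.
have rays_eq B : @RGenInftyO.G R B -> mu B = nu B.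
  by move=> [c ->]; apply/eqP; rewrite eq_le !half // => g cg; rewrite int_eq.
have rays_fin k : (mu `]-oo, (k%:R : R)[%classic < +oo)%E.
  exact: le_lt_trans (probability_le1 _ _) (ltry _).
exact: (@measure_unique _ R R (@RGenInftyO.G R) _ (RGenInftyO.measurableE R) raysI rays
  cover mu nu rays_eq rays_fin A mA).
Qed.

End LawUniqueness.

Lemma norm_fourier_kernel (R : realType) (N : nat) (i j : 'I_N.+1) :
  `|fourier_kernel R i j| = 1.
Proof.
have : `|Defs.root_of_unity R N.+1| ^+ N.+1 = 1.
  by rewrite -normrX root_of_unity_exp1 normr1.
by move=> /eqP; rewrite pexpr_eq1 // normrX => /eqP->; rewrite expr1n.
Qed.

Lemma deformed_fourierE (R : realType) (M N : nat) (Q : 'M[R[i]]_(M.+1, N.+1)) k l :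
  deformed_fourier Q k l
    = Q (mxtens_unindex k).1 (mxtens_unindex l).2
      * fourier_kernel R (mxtens_unindex k).1 (mxtens_unindex l).1
      * fourier_kernel R (mxtens_unindex k).2 (mxtens_unindex l).2.
Proof.
rewrite mxE; case: (mxtens_unindex k) => i a; case: (mxtens_unindex l) => j b.
by rewrite !mxE.
Qed.

Theorem theoremC (R : realType) (M N : nat) (M_gt0 : (0 < M)%N)
    (N_gt0 : (0 < N)%N) (Q : 'M[R[i]]_(M, N))
    (Q_unit : forall i b, `|Q i b| = 1)
    (G : hadamard_qgroup (deformed_fourier Q))
    (Gt : hadamard_qgroup (deformed_fourier Q)^T)
    (h : {scalar G}) (ht : {scalar Gt})
    (h_haar : is_haar h) (ht_haar : is_haar ht)
    (Phi : (R -> R[i]^o) -> G) (Phit : (R -> R[i]^o) -> Gt)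
    (Phi_calc : is_functional_calculus (M * N) (main_char G) Phi)
    (Phit_calc : is_functional_calculus (M * N) (main_char Gt) Phit) :
  (forall phi : R -> R[i]^o, continuous_upto (M * N) phi ->
     h (Phi phi) = ht (Phit phi)) /\
  (forall mu mut : probability R R,
     is_law (M * N) h Phi mu -> is_law (M * N) ht Phit mut ->
     forall A : set R, measurable A -> mu A = mut A).
Proof.
(* Polynomial approximation takes place on an interval of positive length. *)
have MN_gt0 : (0 < M * N)%N by rewrite muln_gt0 M_gt0.
have moments k : h (main_char G ^+ k) = ht (main_char Gt ^+ k).
  (* Successor sizes turn the index sets into the cyclic groups X and Y. *)
  case: M N M_gt0 N_gt0 Q Q_unit G Gt h ht h_haar ht_haar {Phi Phit Phi_calc Phit_calc MN_gt0}
    => [//|M'] [//|N'] _ _ Q0 Q0_unit G0 Gt0 h0 ht0 h0_haar ht0_haar.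
  have H_unit x y : `|deformed_fourier Q0 x y| = 1.
    by rewrite deformed_fourierE !normrM Q0_unit !norm_fourier_kernel !mulr1.
  have kX := fourier_bicharacter R M'; have kY := fourier_bicharacter R N'.
  apply: (main_char_moments H_unit _ kX kY (q := fun i b => Q0 i b) _
    (e' := @mxtens_index M'.+1 N'.+1) (@mxtens_unindexK M'.+1 N'.+1)
    (@mxtens_indexK M'.+1 N'.+1) (@deformed_fourierE R M' N' Q0)) => //.
  - by move=> x y; rewrite mxE.
  - by move=> x y; rewrite -normr_gt0 Q0_unit.
  (* Transposing exchanges the arguments of both Fourier kernels, which are symmetric; only the
     roles of the arguments of [Q0] change. *)
  move=> x y; rewrite mxE deformed_fourierE mulrAC.
  by rewrite (bicharC kX _ (mxtens_unindex x).1) (bicharC kY _ (mxtens_unindex x).2).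
have calc_eq := fcalc_eq MN_gt0 Phi_calc Phit_calc (haar1 h_haar) (haar_pos h_haar)
  (haar1 ht_haar) (haar_pos ht_haar) moments.
split=> [|mu mut [mu1 muE] [mut1 mutE]]; first exact: calc_eq.
apply: (law_unique mu1 mut1) => g cg.
have cg' := continuous_upto_real cg.
by have := calc_eq _ cg'; rewrite muE // mutE // => /(congr1 (@complex.Re R)).
Qed.
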